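(* Let $G$ be a non-elementary relatively hyperbolic group. Then there exists a constant $\kappa=\kappa(G)\in(0,1]$ such that for every non-elementary subgroup $H\le G$ and every finite symmetric generating set $S$ of $H$, $$\omega(H,S)\ \ge\ \kappa\cdot\log \sharp S .$$
   Context: All groups whose growth is considered are finitely generated (in particular $G$ is finitely generated). Growth rate: for a group $H$ with finite symmetric generating set $S=S^{-1}$ and word metric $d_S$, put $S^{\le n}=\{h\in H: d_S(1,h)\le n\}$ and $\omega(H,S)=\lim_{n\to\infty}\frac{\log \sharp(S^{\le n})}{n}$, where $\sharp$ denotes cardinality (the limit exists by submultiplicativity). Relatively hyperbolic groups: $G$ is relatively hyperbolic if it admits a cusp-uniform action, that is, a proper isometric action on a proper geodesic Gromov-hyperbolic space $(X,d)$ such that $G$ does not fix a point of the Gromov boundary $\partial X$, and such that there is a $G$-invariant system $\mathbb U$ of pairwise disjoint open horoballs centered at the parabolic points of $G$ with $G$ acting co-compactly on $X(\mathbb U)=X\setminus\bigcup_{U\in\mathbb U}U$. (A parabolic subgroup is a subgroup whose limit set is a single point; that point is called a parabolic point.) One such action of $G$ on $X$ is fixed. The limit set $\Lambda H\subset\partial X$ of a subgroup $H\le G$ is the set of accumulation points in $\partial X$ of an $H$-orbit in $X$. A subgroup $H$ is non-elementary if $\Lambda H$ contains at least $3$ points; $G$ is non-elementary if $\Lambda G$ contains at least $3$ points. *)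

(* Defs.v *)
From mathcomp Require Import all_boot all_order all_algebra finmap.
From mathcomp Require Import all_classical all_reals all_analysis.

Set Implicit Arguments.
Unset Strict Implicit.
Unset Printing Implicit Defensive.

Import Order.TTheory GRing.Theory Num.Theory numFieldNormedType.Exports.

Local Open Scope classical_set_scope.
Local Open Scope ring_scope.

Definition is_subgroup (G : groupType) (H : set G) : Prop :=
  [/\ H 1%g, forall g h, H g -> H h -> H (g * h)%g
    & forall g, H g -> H (g^-1)%g].

Definition symmetric_set (G : groupType) (S : set G) : Prop :=
  forall s, S s -> S (s^-1)%g.

Definition generates (G : groupType) (S H : set G) : Prop :=
  smallest (@is_subgroup G) S = H.

Definition finitely_generated (G : groupType) : Prop :=
  exists S : set G, finite_set S /\ generates S [set: G].

(* The distance is the least length of a word over S representing g^-1 h.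
   It is meaningful only when S is symmetric and g^-1 h lies in the subgroup
   generated by S; otherwise the set below may be empty, with infimum 0. *)
Definition word_dist (R : realType) (G : groupType) (S : set G) (g h : G) : R :=
  inf [set (size w)%:R | w in
    [set w : seq G | (forall s, s \in w -> S s)
                     /\ (\prod_(s <- w) s = g^-1 * h)%g]].

Definition word_ball (R : realType) (G : groupType) (H S : set G) (n : nat) :
    set G :=
  [set h | H h /\ word_dist R S 1%g h <= n%:R].

Definition growth_rate (R : realType) (G : groupType) (H S : set G) : R :=
  limn (fun n : nat => ln (#|` fset_set (word_ball R H S n)|%:R : R) / n%:R).

Definition proper_space (R : realType) (X : metricType R) : Prop :=
  forall (x : X) (r : R), compact [set y : X | mdist x y <= r].

Definition geodesic_space (R : realType) (X : metricType R) : Prop :=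
  forall x y : X, exists c : R -> X,
    [/\ c 0 = x, c (mdist x y) = y
      & forall s t, 0 <= s <= mdist x y -> 0 <= t <= mdist x y ->
          mdist (c s) (c t) = `|s - t|].

Definition gromov_product (R : realType) (X : metricType R) (w x y : X) : R :=
  (mdist w x + mdist w y - mdist x y) / 2.

Definition gromov_hyperbolic (R : realType) (X : metricType R) : Prop :=
  exists delta : R, forall w x y z : X,
    Num.min (gromov_product w x y) (gromov_product w y z) - delta
      <= gromov_product w x z.

(* (u_i | v_j)_w tends to infinity with i and j; the quantifier over w makes
   this independent of a choice of base point. *)
Definition same_end (R : realType) (X : metricType R) (u v : nat -> X) : Prop :=
  forall (w : X) (M : R), exists N : nat, forall i j : nat,
    (N <= i)%N -> (N <= j)%N -> M <= gromov_product w (u i) (v j).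

Definition tends_to_infinity (R : realType) (X : metricType R) (u : nat -> X) :
  Prop := same_end u u.

(* A point of the Gromov boundary is an equivalence class of sequences tending
   to infinity, represented as the set of its members; a sequence of points of
   X converges to xi in the compactification of X exactly when it belongs to
   xi. *)
Definition gromov_boundary (R : realType) (X : metricType R) :
    set (set (nat -> X)) :=
  [set xi | exists2 u, tends_to_infinity u
                     & xi = [set v | tends_to_infinity v /\ same_end u v]].

Definition is_action (G : groupType) (X : Type) (act : G -> X -> X) : Prop :=
  (forall x, act 1%g x = x) /\
  (forall g h x, act (g * h)%g x = act g (act h x)).

Definition isometric_action (R : realType) (G : groupType) (X : metricType R)
    (act : G -> X -> X) : Prop :=
  forall g x y, mdist (act g x) (act g y) = mdist x y.

Definition proper_action (R : realType) (G : groupType) (X : metricType R)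
    (act : G -> X -> X) : Prop :=
  forall K : set X, compact K ->
    finite_set [set g | (act g @` K) `&` K !=set0].

Definition boundary_act (G : groupType) (X : Type) (act : G -> X -> X)
    (g : G) (xi : set (nat -> X)) : set (nat -> X) :=
  [set (fun n => act g (u n)) | u in xi].

Definition limit_set (R : realType) (G : groupType) (X : metricType R)
    (act : G -> X -> X) (H : set G) : set (set (nat -> X)) :=
  [set xi | @gromov_boundary R X xi /\
    exists (x : X) (h : nat -> G),
      (forall n, H (h n)) /\ xi (fun n => act (h n) x)].

Definition non_elementary (R : realType) (G : groupType) (X : metricType R)
    (act : G -> X -> X) (H : set G) : Prop :=
  exists xi1 xi2 xi3, [/\ limit_set act H xi1, limit_set act H xi2,
    limit_set act H xi3 & [/\ xi1 <> xi2, xi1 <> xi3 & xi2 <> xi3]].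

Definition parabolic_subgroup (R : realType) (G : groupType)
    (X : metricType R) (act : G -> X -> X) (P : set G) : Prop :=
  is_subgroup P /\ exists xi, limit_set act P = [set xi].

Definition parabolic_point (R : realType) (G : groupType) (X : metricType R)
    (act : G -> X -> X) (xi : set (nat -> X)) : Prop :=
  exists P : set G, parabolic_subgroup act P /\ limit_set act P = [set xi].

(* Busemann functions of a hyperbolic space are canonical only up to a bounded
   error, so horofunctions are taken in the coarse sense (Bowditch): h x - h y
   is within a uniform constant of d(x, z) - d(y, z) as z tends to xi, and h
   tends to -oo towards xi.  Busemann functions of geodesic rays ending at xi
   are instances. *)
Definition horofunction (R : realType) (X : metricType R)
    (xi : set (nat -> X)) (h : X -> R) : Prop :=
  exists C : R, forall (x y : X) (u : nat -> X), xi u ->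
    \forall n \near \oo,
      `|(h x - h y) - (mdist x (u n) - mdist y (u n))| <= C.

Definition open_horoball (R : realType) (X : metricType R)
    (xi : set (nat -> X)) (U : set X) : Prop :=
  open U /\ exists h : X -> R, horofunction xi h /\ U = [set x | h x < 0].

Definition cocompact_on (R : realType) (G : groupType) (X : metricType R)
    (act : G -> X -> X) (Y : set X) : Prop :=
  exists K : set X, [/\ compact K, K `<=` Y
                      & Y `<=` \bigcup_(g in [set: G]) (act g @` K)].

Definition horoball_system (R : realType) (G : groupType) (X : metricType R)
    (act : G -> X -> X) (UU : set (set X)) : Prop :=
  [/\ forall U, UU U ->
        exists xi, parabolic_point act xi /\ open_horoball xi U,
      forall g U, UU U -> UU (act g @` U)
    & trivIset UU id].

Record cusp_uniform (R : realType) (G : groupType) (X : metricType R)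
    (act : G -> X -> X) : Prop := {
  cusp_uniform_proper_space : proper_space X;
  cusp_uniform_geodesic : geodesic_space X;
  cusp_uniform_hyperbolic : gromov_hyperbolic X;
  cusp_uniform_action : is_action act;
  cusp_uniform_isometric : isometric_action act;
  cusp_uniform_proper : proper_action act;
  cusp_uniform_no_fixed_point :
    ~ exists xi, @gromov_boundary R X xi /\
                 forall g, boundary_act act g xi = xi;
  cusp_uniform_horoballs : exists UU : set (set X),
    horoball_system act UU /\ cocompact_on act (~` \bigcup_(U in UU) U) }.

(* Main.v *)
Require Import Defs.
From mathcomp Require Import all_boot all_order all_algebra finmap.
From mathcomp Require Import all_classical all_reals all_analysis.
From mathcomp Require Import lra zify.
Import Order.TTheory GRing.Theory Num.Theory numFieldNormedType.Exports.
Local Open Scope classical_set_scope.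
Local Open Scope ring_scope.
Set Implicit Arguments.
Unset Strict Implicit.
Unset Printing Implicit Defensive.

(* Fix a hyperbolicity constant delta >= 1, write (x|y)_o for Gromov products,
   and call a point thick when it lies in no horoball; by cocompactness at most
   M elements move a given thick point by at most 200 delta.

   Replacing S by a ball A of uniform radius, we may assume that A moves every
   point by more than 3000 delta: otherwise some point would lie in a horoball
   stable under H, or A would be conjugate into a finite set of bounded size.
   Choose o almost minimising the maximal displacement of A. Moving o cannot
   shorten all long elements at once, so A or AA contains an element b with
   (b^-1 o|b o)_o <= 7 delta and d(o, b o) comparable to that displacement; its
   powers follow a quasi-axis, and every period of this axis contains a thick
   point, since b stabilises no horoball.

   If g displaces o by at most 8 d(o, b o) and maps a long piece of the axis
   (m periods, m depending only on M) along itself, the elements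
   b^-i g^-1 b^i g with i <= M move a thick point by at most 110 delta, so two
   of them coincide and g commutes with a power of b; an overlap with the
   reversed axis gives g b^k = b^-k g in the same way. As H is non-elementary,
   some h in A maps no power of b to itself or its inverse, and an element
   commuting with powers of both b and h b h^-1 almost fixes three ends, so it
   moves a thick point very little.

   Say that u and v clash when u b^m o and v b^m o lie in nearly the same
   direction from o. Elements without clashes give, up to one of them, elements
   u b^m that freely generate a free semigroup. Let T be a maximal clash-free
   subset of A, E a largest clash class, and F a subset of E, maximal with F h
   clash-free. Then |A| <= |T| |E| and |E| <= M |F|, hence one of {1, h}, T,
   F h yields a free semigroup on at least c |A|^(1/2) words of bounded length,
   so omega(H, S) >= kappa log |S|. *)

(* [mdist] takes its values in [R] seen as a [numDomainType]; this copy lands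
   in [R] itself, which is what [lra] recognises. *)
Definition dist (R : realType) (X : metricType R) (x y : X) : R := mdist x y.
Local Notation d := dist.
Local Notation gp := gromov_product.

(** * Gromov products in metric spaces *)

Section MetricSpaces.
Context (R : realType) (X : metricType R).
Implicit Types x y z w : X.

Lemma dist_ge0 x y : 0 <= d x y. Proof. exact: mdist_ge0. Qed.

Lemma distxx x : d x x = 0. Proof. exact: mdistxx. Qed.

Lemma distC x y : d x y = d y x. Proof. exact: metric_sym. Qed.

Lemma dist_triangle x y z : d x z <= d x y + d y z.
Proof. exact: metric_triangle. Qed.

Lemma gpE w x y : gp w x y = (d w x + d w y - d x y) / 2.
Proof. by []. Qed.

Lemma gpC w x y : gp w x y = gp w y x.
Proof. rewrite !gpE (distC x y); lra. Qed.

Lemma gp_le w x y : gp w x y <= d w x.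
Proof.
rewrite !gpE; have := dist_triangle w x y; lra.
Qed.

Lemma gp_ge0 w x y : 0 <= gp w x y.
Proof.
rewrite !gpE; have := dist_triangle x w y.
rewrite (distC x w); lra.
Qed.

Lemma gp0 w x : gp w x w = 0.
Proof. by rewrite !gpE distxx (distC x w); lra. Qed.

Lemma gpB w x y : gp w x y = d w x - gp x w y.
Proof. rewrite !gpE (distC x w); lra. Qed.

Lemma gp_ge w x y : d w x - d x y <= gp w x y.
Proof. by rewrite gpB gpC lerD2l lerN2 gp_le. Qed.

Lemma gp_base w w' x y : gp w x y <= gp w' x y + d w w'.
Proof.
rewrite !gpE.
have := dist_triangle w w' x; have := dist_triangle w w' y; lra.
Qed.

Lemma gp_dist w x x' y : gp w x y <= gp w x' y + d x x'.
Proof.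
rewrite !gpE.
have := dist_triangle w x' x; have := dist_triangle x' x y.
rewrite (distC x' x); lra.
Qed.

End MetricSpaces.

(** * Consequences of the four-point inequality *)

Section HyperbolicGeometry.
Context (R : realType) (X : metricType R) (delta : R).
Hypothesis hyp : forall w x y z : X,
  Num.min (gp w x y) (gp w y z) - delta <= gp w x z.
Implicit Types w x y z : X.

Lemma gp_hyp w x y z :
  gp w x y - delta <= gp w x z \/ gp w y z - delta <= gp w x z.
Proof. by have := hyp w x y z; rewrite /Num.min; case: ifP => _; [left|right]. Qed.

(** Seen from [w], the point [y] leaves [x] before [z] does, so [y] leaves [z] there as well. *)
Lemma gp_replace w x y z (k : R) :
  gp w x y <= k -> k + delta < gp w x z -> gp w z y <= k + delta.
Proof. by move=> xy xz; have := gp_hyp w x z y; case; lra. Qed.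

Lemma four_point x y z w :
  d x z + d y w <= d x y + d z w + 2 * delta \/
  d x z + d y w <= d x w + d y z + 2 * delta.
Proof.
have := gp_hyp w x y z; rewrite !gpE.
by rewrite !(distC w); case=> ?; [left|right]; lra.
Qed.

(** Seen from [y], the points [p] and [p'] separate only beyond distance [d y y'], so for the pair
    [y], [y'] they act like a common point at infinity. *)
Lemma busemann p p' y y' : d y y' <= gp y p p' ->
  `|(d p y' - d p y) - (d p' y' - d p' y)| <= 2 * delta.
Proof.
move=> h; rewrite ler_norml.
have h1 := gp_le y y' p; have h2 := gp_le y y' p'.
have := gp_hyp y p' p y'; have := gp_hyp y p p' y'.
move: h h1 h2; rewrite !gpE !(distC _ y') !(distC y).
rewrite (distC p' p) (distC y' y).
by move=> h h1 h2; case=> h3; case=> h4; apply/andP; split; lra.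
Qed.

Lemma near_line_close p q y y' (k k' : R) :
    gp y p q <= k -> gp y' p q <= k ->
    `|d y q - d y' q| <= k' ->
  d y y' <= k' + 2 * k + 2 * delta.
Proof.
rewrite ler_norml => hy hy' /andP[h1 h2].
have := four_point y p y' q; move: hy hy'; rewrite !gpE.
rewrite !(distC p).
by move=> hy hy'; case; lra.
Qed.

End HyperbolicGeometry.

(** * Isometric actions and ping-pong for words *)

Section IsometricActions.
Context (R : realType) (G : groupType) (X : metricType R) (act : G -> X -> X).
Hypothesis act_action : is_action act.
Hypothesis act_isom : isometric_action act.
Implicit Types (g h : G) (x y z : X).

Lemma act1 x : act 1%g x = x. Proof. by case: act_action. Qed.

Lemma actM g h x : act (g * h)%g x = act g (act h x).
Proof. by case: act_action. Qed.

Lemma actK g : cancel (act g) (act g^-1%g).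
Proof. by move=> x; rewrite -actM mulVg act1. Qed.

Lemma actKV g : cancel (act g^-1%g) (act g).
Proof. by move=> x; rewrite -actM mulgV act1. Qed.

Lemma dist_isom g x y : d (act g x) (act g y) = d x y.
Proof. exact: act_isom. Qed.

Lemma dist_act g x y : d x (act g y) = d (act g^-1%g x) y.
Proof. by rewrite -{1}(actKV g x) dist_isom. Qed.

Lemma dist_act_inv g x : d x (act g^-1%g x) = d x (act g x).
Proof. by rewrite dist_act invgK distC. Qed.

Lemma dist_act_mul g h x : d x (act (g * h)%g x) <= d x (act g x) + d x (act h x).
Proof.
rewrite actM; apply: le_trans (dist_triangle x (act g x) _) _.
by rewrite dist_isom.
Qed.

Lemma gp_act g w x y : gp (act g w) (act g x) (act g y) = gp w x y.
Proof. by rewrite !gpE !dist_isom. Qed.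

Variable delta : R.
Hypothesis hyp : forall w x y z : X,
  Num.min (gp w x y) (gp w y z) - delta <= gp w x z.
Hypothesis delta_ge0 : 0 <= delta.

(** Local-to-global principle for broken geodesics. By induction the tail of the word turns away
    from [v^-1], so from [o] the whole word leaves along its first letter [v], and [gp_replace]
    trades [v] for the word. The loss is a single [delta], whatever the length. *)
Lemma gp_word (V : pred G) (o : X) (k : R) :
    (forall u v, V u -> V v -> gp o (act u^-1%g o) (act v o) <= k) ->
    (forall v, V v -> 2 * k + 2 * delta < d o (act v o)) ->
  forall (u : G) (w : seq G), V u -> w != [::] -> all V w ->
    gp o (act u^-1%g o) (act (\prod_(s <- w) s)%g o) <= k + delta.
Proof.
move=> turn long u w Vu; elim: w u Vu => [//|v w IH] u Vu _ /= /andP[Vv Vw].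
rewrite big_cons; have := turn _ _ Vu Vv; rewrite !(gpC _ (act u^-1%g o)).
move=> uv; apply: (gp_replace hyp uv).
case: (eqVneq w [::]) => [->|w0].
  rewrite big_nil mulg1 !gpE distxx.
  have := long _ Vv; have := turn _ _ Vv Vv; move: delta_ge0.
  have := dist_ge0 o (act v o); lra.
have := IH v Vv w0 Vw; rewrite -(gp_act v) -!actM mulgV act1.
rewrite [ltRHS]gpB; by have := long _ Vv; lra.
Qed.

(** Ping-pong: every word follows its first letter for almost the whole length of that letter
    ([ahead]), so equal products force first letters that separate late. By the separation bound
    these coincide and can be cancelled. *)
Lemma word_inj (V : pred G) (o : X) (k k' : R) :
    (forall u v, V u -> V v -> gp o (act u^-1%g o) (act v o) <= k) ->
    (forall u v, V u -> V v -> u != v -> gp o (act u o) (act v o) <= k') ->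
    (forall v, V v -> 2 * k + 2 * delta < d o (act v o)) ->
    (forall v, V v -> k + k' + 2 * delta < d o (act v o)) ->
  forall w w' : seq G, size w = size w' -> all V w -> all V w' ->
    (\prod_(s <- w) s = \prod_(s <- w') s)%g -> w = w'.
Proof.
move=> turn sep long long'; elim=> [|v w IH] [|v' w'] //= [ww'].
move=> /andP[Vv Vw] /andP[Vv' Vw']; rewrite !big_cons => E.
have [vv'|vv'] := eqVneq v v'.
  by move: E; rewrite vv' => /mulgI /(IH _ ww' Vw Vw') ->.
exfalso.
have ahead s r : V s -> all V r ->
    d o (act s o) - (k + delta) <=
    gp o (act s o) (act (s * \prod_(s <- r) s)%g o).
  move=> Vs Vr; rewrite gpB lerD2l lerN2.
  rewrite -(gp_act s^-1%g) actK -!actM mulKg.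
  case: (eqVneq r [::]) => [->|r0]; last exact: (gp_word turn long Vs r0 Vr).
  rewrite big_nil act1 gp0.
  move: (turn s s Vs Vs) (gp_ge0 o (act s^-1%g o) (act s o)) delta_ge0; lra.
have h1 := ahead _ _ Vv Vw; have h2 := ahead _ _ Vv' Vw'.
have h3 := sep _ _ Vv Vv' vv'; have h4 := long' _ Vv.
have h5 := long' _ Vv'.
rewrite -E gpC in h2.
have h6 := gp_hyp hyp o (act v o) (act (v * \prod_(s <- w) s)%g o) (act v' o).
by case: h6 => h6; move: h1 h2 h3 h4 h5 h6; lra.
Qed.

End IsometricActions.

(** * Straight elements from large displacement *)

Section LargeDisplacement.
Context (R : realType) (G : groupType) (X : metricType R) (act : G -> X -> X).
Hypothesis act_action : is_action act.
Hypothesis act_isom : isometric_action act.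
Hypothesis geod : geodesic_space X.
Context (delta : R).
Hypothesis hyp : forall w x y z : X,
  Num.min (gp w x y) (gp w y z) - delta <= gp w x z.
Hypothesis delta_ge1 : 1 <= delta.

Lemma geodesic_point (x y : X) (r : R) : 0 <= r <= d x y ->
  exists z, d x z = r /\ d z y = d x y - r.
Proof.
move=> /andP[r0 rxy]; have [c [c0 c1 cE]] := geod x y; exists (c r).
have dxy : (0 <= d x y <= d x y) by rewrite dist_ge0 lexx.
have r0d : 0 <= r <= d x y by rewrite r0.
have o0d : 0 <= (0:R) <= d x y by rewrite lexx dist_ge0.
split; first by rewrite -{1}c0 /dist (cE 0 r)// sub0r normrN ger0_norm.
by rewrite -{1}c1 /dist (cE _ _ r0d dxy) distrC ger0_norm // subr_ge0.
Qed.

Variables (S : set G) (o : X) (L : R).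
Hypothesis S_sym : symmetric_set S.
Hypothesis S_le : forall s, S s -> d o (act s o) <= L.
Hypothesis S_ge : forall y, exists2 s, S s & L - 1 < d y (act s y).
Hypothesis L_large : 1000 * delta <= L.

(* If all long elements moved [o] in the same direction, moving [o] by
   [4 * delta] in that direction would decrease the maximal displacement. *)
Lemma long_transverse_pair : exists s t, [/\ S s, S t,
  L - 9 * delta <= d o (act s o), L - 9 * delta <= d o (act t o) &
  gp o (act s o) (act t o) <= 4 * delta].
Proof.
have d1 := delta_ge1; have Ll := L_large; apply: contrapT => no.
have far s t : S s -> S t -> L - 9 * delta <= d o (act s o) ->
    L - 9 * delta <= d o (act t o) -> 4 * delta < gp o (act s o) (act t o).
  by move=> Ss St hs ht; rewrite ltNge; apply/negP => h; apply: no; exists s, t.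
have [s Ss hs] := S_ge o.
have [] := @geodesic_point o (act s o) (4 * delta).
  by apply/andP; split; lra.
move=> y [oy ys]; have [t St] := S_ge y; apply/negP; rewrite -leNgt.
have ls : L - 9 * delta <= d o (act s o) by lra.
have ty := dist_isom act_isom t o y.
(* Moving the base point by [4 * delta] changes a displacement by at most [8 * delta]; the ninth
   [delta] absorbs the [1] in [S_ge]. *)
have [lt|lt] := leP (L - 9 * delta) (d o (act t o)); last first.
  have h1 := dist_triangle y o (act t y).
  have h2 := dist_triangle o (act t o) (act t y).
  by rewrite (distC y o) in h1; lra.
have f1 := far _ _ Ss St ls lt.
have f2 : 4 * delta < gp o (act s o) (act t^-1%g o).
  by apply: far => //; [exact: S_sym | rewrite dist_act_inv].
have g0 : gp o y (act s o) = 4 * delta by rewrite gpE; lra.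
have g1 : 3 * delta <= gp o y (act t o).
  by have [h|h] := gp_hyp hyp o y (act s o) (act t o); lra.
have g2 : 3 * delta <= gp o y (act t^-1%g o).
  by have [h|h] := gp_hyp hyp o y (act s o) (act t^-1%g o); lra.
rewrite gpE dist_act_inv // (dist_act act_action act_isom _ y) invgK in g2.
rewrite gpE in g1; have h3 := distC o (act t y); have Lt := S_le St.
by have [h|h] := four_point hyp o y (act t o) (act t y); lra.
Qed.

(** If neither [s] nor [t] is straight, [s^-1 o] lies in the direction of [s o] and [t^-1 o] in that
    of [t o]. These directions being transverse, little cancels in [s * t], which leaves along [s]
    while its inverse leaves along [t^-1]. *)
Lemma exists_straight_element : exists b,
  [/\ S b \/ exists s t, [/\ S s, S t & b = (s * t)%g],
      gp o (act b^-1%g o) (act b o) <= 7 * delta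
    & L / 2 <= d o (act b o)].
Proof.
have d1 := delta_ge1; have Ll := L_large.
have [s [t [Ss St ls lt st]]] := long_transverse_pair.
have [hs|hs] := leP (gp o (act s^-1%g o) (act s o)) (5 * delta).
  by exists s; split; [left | lra | lra].
have [ht|ht] := leP (gp o (act t^-1%g o) (act t o)) (5 * delta).
  by exists t; split; [left | lra | lra].
exists (s * t)%g.
have h1 : gp o (act s^-1%g o) (act t o) <= 5 * delta.
  have := gp_hyp hyp o (act s o) (act s^-1%g o) (act t o).
  by rewrite (gpC _ (act s o)); case=> ?; lra.
have h2 : gp o (act s o) (act t^-1%g o) <= 5 * delta.
  have := gp_hyp hyp o (act s o) (act t^-1%g o) (act t o).
  by case=> ?; lra.
have f (u v : G) : gp o (act u o) (act (u * v)%g o) =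
    d o (act u o) - gp o (act u^-1%g o) (act v o).
  by rewrite gpB -(gp_act act_isom u^-1%g) actK -?actM ?mulKg.
have k1 := f s t; have k2 := f t^-1%g s^-1%g.
rewrite invgK (gpC o (act t o)) dist_act_inv // -invgM in k2.
have m1 : gp o (act t^-1%g o) (act (s * t)%g o) <= 6 * delta.
  have := gp_hyp hyp o (act t^-1%g o) (act (s * t)%g o) (act s o).
  by rewrite (gpC _ (act (s * t)%g o) (act s o)) (gpC _ _ (act s o)); case=> ?; lra.
split.
- by right; exists s, t.
- have := gp_hyp hyp o (act t^-1%g o) (act (s * t)^-1%g o) (act (s * t)%g o).
  by case=> ?; lra.
- have := dist_isom act_isom s^-1%g o (act (s * t)%g o).
  rewrite -actM // mulKg; rewrite gpE in h1; rewrite dist_act_inv // in h1.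
  have := distC (act s^-1%g o) (act t o); lra.
Qed.

End LargeDisplacement.

(** * The quasi-axis of a straight element *)

Section QuasiAxis.
Context (R : realType) (G : groupType) (X : metricType R) (act : G -> X -> X).
Hypothesis act_action : is_action act.
Hypothesis act_isom : isometric_action act.
Context (delta : R).
Hypothesis hyp : forall w x y z : X,
  Num.min (gp w x y) (gp w y z) - delta <= gp w x z.
Hypothesis delta_ge1 : 1 <= delta.
Variables (b : G) (o : X).
Local Notation t n := (d o (act (b ^+ n)%g o)).

Lemma dist_expg i j : d (act (b ^+ i)%g o) (act (b ^+ (i + j))%g o) = t j.
Proof. by rewrite expgnDr actM // dist_isom. Qed.

Lemma dist_expVg i : d o (act (b ^+ i)^-1%g o) = t i.
Proof. exact: dist_act_inv. Qed.

Lemma dist_expg_expVg i j :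
  d (act (b ^+ i)^-1%g o) (act (b ^+ j)%g o) = t (i + j)%N.
Proof.
by rewrite -(dist_isom act_isom (b ^+ i)%g) actKV // -actM // -expgnDr.
Qed.

Lemma dist_expg_le_add i j : t (i + j)%N <= t i + t j.
Proof. by rewrite -dist_expg_expVg -dist_expVg (distC o); exact: dist_triangle. Qed.

Lemma dist_expg_le n : t n <= n%:R * t 1%N.
Proof.
elim: n => [|n IH]; first by rewrite mul0r expg0 act1 // distxx.
have := dist_expg_le_add 1 n; rewrite add1n -addn1 natrD; lra.
Qed.

Hypothesis b_straight : gp o (act b^-1%g o) (act b o) <= 7 * delta.
Hypothesis b_long : 1000 * delta <= d o (act b o).

Lemma gp_inv_expg n : gp o (act b^-1%g o) (act (b ^+ n)%g o) <= 8 * delta.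
Proof.
have d1 := delta_ge1; have bl := b_long.
case: n => [|n]; first by rewrite expg0 act1 // gp0; lra.
have -> : (b ^+ n.+1 = \prod_(s <- nseq n.+1 b) s)%g.
  by rewrite big_nseq iter_mulg_1.
have -> : 8 * delta = 7 * delta + delta by lra.
have d0 : 0 <= delta by lra.
apply: (@gp_word _ _ _ act act_action act_isom delta hyp d0 (pred1 b)).
- by move=> _ _ /eqP-> /eqP->.
- by move=> _ /eqP->; lra.
- by rewrite /= eqxx.
- by [].
- by apply/allP => x; rewrite mem_nseq.
Qed.

Lemma dist_expgS_ge n : t n + t 1%N - 16 * delta <= t n.+1.
Proof.
have := gp_inv_expg n.
have := dist_expg_expVg 1 n; have := dist_expVg 1.
by rewrite !expg1 gpE add1n => -> ->; lra.
Qed.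

(** The defect of additivity is twice a Gromov product at [o]; [gp_replace] passes from [b^-1] in
    [gp_inv_expg] to a higher negative power at the cost of one [delta]. *)
Lemma dist_expg_ge_add i j : t i + t j - 18 * delta <= t (i + j)%N.
Proof.
have d1 := delta_ge1; have bl := b_long.
case: i => [|i]; first by rewrite add0n expg0 act1 // distxx; lra.
suff : gp o (act (b ^+ i.+1)^-1%g o) (act (b ^+ j)%g o) <= 8 * delta + delta.
  rewrite gpE dist_expg_expVg dist_expVg; lra.
apply: (gp_replace hyp (gp_inv_expg j)).
rewrite gpE dist_act_inv // dist_expVg.
have -> : d (act b^-1%g o) (act (b ^+ i.+1)^-1%g o) = t i.
  by rewrite expgS invgM actM // -dist_expVg ?dist_isom// -actM // -invgM -expgS
    expgSr invgM actM // dist_isom.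
have := dist_expgS_ge i; rewrite expg1; lra.
Qed.

Lemma dist_expg_ge n : n%:R * (t 1%N / 2) <= t n.
Proof.
have d1 := delta_ge1; have bl := b_long.
elim: n => [|n IH]; first by rewrite mul0r dist_ge0.
have := dist_expgS_ge n; move: IH; rewrite -(addn1 n) natrD expg1; lra.
Qed.

End QuasiAxis.

(** * Translates that fellow-travel the axis *)

Section FellowTravelling.
Context (R : realType) (G : groupType) (X : metricType R) (act : G -> X -> X).
Hypothesis act_action : is_action act.
Hypothesis act_isom : isometric_action act.
Context (delta : R).
Hypothesis hyp : forall w x y z : X,
  Num.min (gp w x y) (gp w y z) - delta <= gp w x z.
Hypothesis delta_ge1 : 1 <= delta.
Variables (b : G) (o : X).
Local Notation t n := (d o (act (b ^+ n)%g o)).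
Hypothesis b_straight : gp o (act b^-1%g o) (act b o) <= 7 * delta.
Hypothesis b_long : 1000 * delta <= t 1.
Variable p : X.
Hypothesis p_between : d o p + d p (act b o) = t 1.

Let ge_add := dist_expg_ge_add act_action act_isom hyp delta_ge1 b_straight b_long.
Let le_add := dist_expg_le_add act_action act_isom b o.

Lemma dist_between_expg n :
  (0 < n)%N -> t n - d o p <= d p (act (b ^+ n)%g o) <= t n - d o p + 18 * delta.
Proof.
case: n => [//|n] _; apply/andP; split.
  by have := dist_triangle o p (act (b ^+ n.+1)%g o); lra.
have := dist_triangle p (act b o) (act (b ^+ n.+1)%g o).
have := dist_expg act_action act_isom b o 1 n; rewrite expg1 add1n => ->.
by have := ge_add 1 n; have := p_between; rewrite expg1; lra.
Qed.

Lemma dist_expg_between n :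
  t n + d o p - 18 * delta <= d o (act (b ^+ n)%g p) <= t n + d o p.
Proof.
rewrite [d o (act _ p)]dist_act // [d (act _ o) p]distC; apply/andP; split.
  have := dist_triangle (act b o) p (act (b ^+ n)^-1%g o).
  have := dist_expg_expVg act_action act_isom b o n 1; rewrite expg1.
  have := ge_add n 1; have := p_between; rewrite expg1.
  by rewrite (distC (act b o) p) (distC (act b o)); lra.
have := dist_triangle p o (act (b ^+ n)^-1%g o).
by rewrite dist_expVg // (distC p o); lra.
Qed.

Lemma gp_between_expg n : (0 < n)%N ->
  gp p (act (b ^+ n)^-1%g o) (act (b ^+ n)%g o) <= 18 * delta.
Proof.
move=> n0; rewrite gpE dist_expg_expVg // [d p (act _^-1%g o)]dist_act //.
rewrite invgK [d (act _ p) o]distC.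
have /andP[_] := dist_between_expg n0; have /andP[_] := dist_expg_between n.
by have := ge_add n n; lra.
Qed.

Variables (c g : G) (M m : nat).
Hypothesis c_t : forall n, d o (act (c ^+ n)%g o) = t n.
Hypothesis m_large : (10 * (M + 100) <= m)%N.
Hypothesis g_le : d o (act g o) <= 8 * t 1.
Hypothesis g_follows : (M + 80)%:R * t 1 <=
  gp o (act (c ^+ m)%g o) (act g (act (b ^+ m)%g o)).

Let dist_expg_le_M i : (i <= M)%N -> t i <= M%:R * t 1.
Proof.
move=> iM; apply: le_trans (dist_expg_le act_action act_isom b o i) _.
by rewrite ler_wpM2r ?dist_ge0 // ler_nat.
Qed.

Let dist_expg20_ge i : 10 * t 1 <= t (i + 20).
Proof.
have := dist_expg_ge act_action act_isom hyp delta_ge1 b_straight b_long (i + 20).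
have : 0 <= i%:R * (t 1 / 2) by rewrite mulr_ge0 // divr_ge0 // dist_ge0.
by rewrite natrD; lra.
Qed.

Let dist_expg_large_ge n : (4 * M + 400 <= n)%N -> 2 * (M%:R * t 1) + 200 * t 1 <= t n.
Proof.
move=> nM.
have := dist_expg_ge act_action act_isom hyp delta_ge1 b_straight b_long n.
have : (4 * M + 400)%:R * t 1 <= n%:R * t 1.
  by rewrite ler_wpM2r ?dist_ge0 // ler_nat.
by rewrite natrD natrM; lra.
Qed.

Let dist_expg_twenty_le : t 20 <= 20 * t 1.
Proof. exact: dist_expg_le. Qed.

(** The point lies near the segment from [g o] to [g b^m o]. The first end may be replaced by [o]:
    the shift by [20] periods puts the point about [10 * t 1] or more away from [g o], while [g]
    moves [o] by at most [8 * t 1]. The second may be replaced by [c^m o] thanks to [g_follows]. *)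
Lemma follow_near_axis i : (i <= M)%N ->
  gp (act g (act (b ^+ (i + 20))%g p)) o (act (c ^+ m)%g o) <= 20 * delta.
Proof.
move=> iM; have d1 := delta_ge1; have bl := b_long; have gl := g_le.
have gf := g_follows; rewrite natrD mulrDl in gf.
have pb := p_between; have p0 := dist_ge0 p (act b o); have p1 := dist_ge0 o p.
have ti := dist_expg_le_M iM; have tj := dist_expg20_ge i.
have tj' := le_add i 20; have t20 := dist_expg_twenty_le.
have [jm jmE] : (0 < m - (i + 20))%N /\ ((i + 20) + (m - (i + 20)) = m)%N.
  by move: iM m_large; clear; lia.
have tm := ge_add (i + 20) (m - (i + 20)); rewrite jmE in tm.
have /andP[_ Bu] := dist_between_expg jm.
have /andP[Al Au] := dist_expg_between (i + 20).
set q := act (b ^+ (i + 20))%g p; set y := act g q.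
have E1 : d (act g o) y = d o q by exact: dist_isom.
have E2 : d y (act g (act (b ^+ m)%g o)) = d p (act (b ^+ (m - (i + 20)))%g o).
  by rewrite /y dist_isom // -{1}jmE expgnDr actM // dist_isom.
have h1 : gp y (act g o) (act g (act (b ^+ m)%g o)) <= 18 * delta.
  by rewrite gpE E2 (distC y) E1 dist_isom //; lra.
have h2 : 18 * delta + delta < gp y (act g o) o.
  have := gp_ge y (act g o) o; rewrite (distC y) E1 (distC _ o); lra.
have h3 := gp_replace hyp h1 h2.
have oy := dist_triangle o (act g o) y; rewrite E1 in oy.
have h4 : 18 * delta + delta + delta <
    gp y (act g (act (b ^+ m)%g o)) (act (c ^+ m)%g o).
  have := gp_base o y (act (c ^+ m)%g o) (act g (act (b ^+ m)%g o)).
  by rewrite (gpC y); lra.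
rewrite gpC in h3; have := gp_replace hyp h3 h4; rewrite gpC; lra.
Qed.

(** Both points lie near the segment from [o] to [c^m o], and both arise from [g b^20 p] by
    advancing about [t i] along it. Their distances to [c^m o] thus almost agree, and
    [near_line_close] applies. *)
Lemma follow_commute i : (i <= M)%N ->
  d (act g (act (b ^+ (i + 20))%g p)) (act (c ^+ i)%g (act g (act (b ^+ 20)%g p)))
    <= 110 * delta.
Proof.
move=> iM; have d1 := delta_ge1; have bl := b_long; have gl := g_le.
have gf := g_follows; rewrite natrD mulrDl in gf.
have pb := p_between; have p0 := dist_ge0 p (act b o); have p1 := dist_ge0 o p.
have ti := dist_expg_le_M iM; have t20 := dist_expg_twenty_le.
have A0 : 0 <= M%:R * t 1 by rewrite mulr_ge0 // dist_ge0.
have ny := follow_near_axis iM; have nz := follow_near_axis (leq0n M).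
rewrite add0n in nz.
set z := act g (act (b ^+ 20)%g p) in nz *.
set y := act g _ in ny *; set v := act (c ^+ i)%g z; set Q := act _ o in ny nz.
have miE : (i + (m - i) = m)%N by move: iM m_large; clear; lia.
have tmi : 2 * (M%:R * t 1) + 200 * t 1 <= t (m - i).
  by apply: dist_expg_large_ge; move: iM m_large; clear; lia.
have tm := ge_add i (m - i); rewrite miE in tm.
have tmu := le_add i (m - i); rewrite miE in tmu.
have oz : d o z <= 29 * t 1.
  have := dist_triangle o (act g o) z; rewrite {2}/z dist_isom //.
  by have /andP[_] := dist_expg_between 20; lra.
have Qmi : d Q (act (c ^+ (m - i))%g o) = t i.
  by rewrite /Q -{1}miE addnC distC dist_expg // c_t.
have nv : gp v o Q <= 30 * delta.
  have h1 : gp z (act (c ^+ i)^-1%g o) Q <= 29 * delta.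
    move: nz; rewrite !gpE dist_expg_expVg // c_t.
    have := dist_triangle z o (act (c ^+ i)^-1%g o).
    by rewrite dist_expVg // c_t; have := ge_add i m; rewrite /Q c_t; lra.
  have h2 : 29 * delta + delta < gp z Q (act (c ^+ (m - i))%g o).
    have := gp_base o z Q (act (c ^+ (m - i))%g o).
    by rewrite gpE Qmi /Q !c_t; lra.
  rewrite gpC in h1; have := gp_replace hyp h1 h2.
  rewrite -(gp_act act_isom (c ^+ i)%g) actKV // -actM // -expgnDr miE gpC; lra.
(* Seen from [z], the ends [c^m o] and [g b^m o] separate beyond [y], so the progress from [z] to
   [y] can be measured along the translated axis. *)
have E1 : `|(d Q y - d Q z) - (d (act g (act (b ^+ m)%g o)) y -
    d (act g (act (b ^+ m)%g o)) z)| <= 2 * delta.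
  apply: (busemann hyp).
  have : d z y <= M%:R * t 1 + 2 * t 1.
    rewrite /z /y dist_isom // addnC expgnDr.
    rewrite (actM act_action (b ^+ 20)%g) dist_isom //.
    have := dist_triangle p o (act (b ^+ i)%g p); rewrite (distC p o).
    by have /andP[_] := dist_expg_between i; lra.
  have := gp_base o z Q (act g (act (b ^+ m)%g o)); lra.
have E2 : `|(d (act (c ^+ (m - i))%g o) z - d (act (c ^+ (m - i))%g o) o) -
    (d Q z - d Q o)| <= 2 * delta.
  apply: (busemann hyp).
  by rewrite gpE (distC (act _ o) Q) Qmi /Q !c_t; lra.
have vQ : d v Q = d (act (c ^+ (m - i))%g o) z.
  by rewrite /Q -{1}miE expgnDr actM // dist_isom // distC.
have QjE k : (k + 20 < m)%N -> d (act g (act (b ^+ m)%g o)) (act g (act (b ^+ (k + 20))%g p))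
    = d p (act (b ^+ (m - (k + 20)))%g o).
  move=> km; rewrite dist_isom // distC -{1}(subnKC (ltnW km)).
  by rewrite (expgnDr b (k + 20)) (actM act_action (b ^+ (k + 20))%g) dist_isom.
have [im m20] : (i + 20 < m)%N /\ (0 + 20 < m)%N.
  by move: iM m_large; clear; lia.
have Qy := QjE i im; have Qz := QjE 0%N m20; rewrite add0n -/z in Qz.
rewrite -/y in Qy; rewrite Qy Qz in E1.
have [] : (0 < m - (i + 20))%N /\ (0 < m - 20)%N.
  by move: iM m_large; clear; lia.
move=> /dist_between_expg/andP[k1 k2] /dist_between_expg/andP[k3 k4].
have m20E : (i + (m - (i + 20)) = m - 20)%N.
  by move: iM m_large; clear; lia.
have k5 := ge_add i (m - (i + 20)); have k6 := le_add i (m - (i + 20)).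
rewrite m20E in k5 k6.
have : `|d y Q - d v Q| <= 40 * delta.
  move: E1 E2; rewrite vQ !ler_norml (distC y) !(distC _ o) !c_t.
  move=> /andP[? ?] /andP[? ?]; apply/andP; split; lra.
have ny' : gp y o Q <= 30 * delta by lra.
move=> /(near_line_close hyp ny' nv); lra.
Qed.

End FellowTravelling.

(* Stated for lists, so that it makes sense without knowing the set of elements
   moving [x] little to be finite. *)
Definition few_movers (R : realType) (G : groupType) (X : metricType R)
    (act : G -> X -> X) (M : nat) (r : R) (x : X) :=
  forall s : seq G, uniq s -> (forall g, g \in s -> d x (act g x) <= r) ->
    (size s <= M)%N.

(** * Rigidity: overlaps force commutation *)

Section Rigidity.
Context (R : realType) (G : groupType) (X : metricType R) (act : G -> X -> X).
Hypothesis act_action : is_action act.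
Hypothesis act_isom : isometric_action act.
Context (delta : R).
Hypothesis hyp : forall w x y z : X,
  Num.min (gp w x y) (gp w y z) - delta <= gp w x z.
Hypothesis delta_ge1 : 1 <= delta.

Lemma few_movers_collision M r x (f : nat -> G) : few_movers act M r x ->
    (forall i, (i <= M)%N -> d x (act (f i) x) <= r) ->
  exists i j, [/\ (i < j)%N, (j <= M)%N & f i = f j].
Proof.
move=> few small; apply: contrapT => no.
have : (size [seq f i | i <- iota 0 M.+1] <= M)%N.
  apply: few => [|g /mapP[i]]; last first.
    by rewrite mem_iota add0n ltnS => /andP[_ iM] ->; exact: small.
  rewrite map_inj_in_uniq ?iota_uniq // => i j.
  rewrite !mem_iota !add0n !ltnS => /andP[_ iM] /andP[_ jM] fij.
  case: (ltngtP i j) => // ij; exfalso; apply: no.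
    by exists i, j.
  by exists j, i.
by rewrite size_map size_iota ltnn.
Qed.

Lemma few_movers_act M r x (g : G) :
  few_movers act M r x -> few_movers act M r (act g x).
Proof.
move=> few s us small; rewrite -(size_map (fun h => h ^ g)%g).
apply: few; first by rewrite map_inj_uniq //; exact: conjg_inj.
move=> _ /mapP[h hs ->]; rewrite conjgE !actM // -(dist_isom act_isom g) actKV //.
exact: small.
Qed.

Lemma gp_perturb (z p p' q q' : X) (B : R) : gp z p q <= B ->
    B + 5 * delta < gp z p p' -> B + 5 * delta < gp z q q' ->
  `|gp z p' q' - gp z p q| <= 2 * delta.
Proof.
move=> pq pp qq; rewrite ler_norml; have d1 := delta_ge1.
have h1 : gp z p' q <= gp z p q + delta.
  by have [h|h] := gp_hyp hyp z p p' q; lra.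
have h2 : gp z p' q' <= gp z p' q + delta.
  by have := gp_hyp hyp z p' q' q; rewrite (gpC z q' q) => -[h|h]; lra.
have h3 : gp z p q' <= gp z p' q' + delta.
  by have := gp_hyp hyp z p' p q'; rewrite (gpC z p' p) => -[h|h]; lra.
have h4 : gp z p q <= gp z p q' + delta.
  by have [h|h] := gp_hyp hyp z p q q'; lra.
by apply/andP; split; lra.
Qed.

(* Put [e_i = d (g p_i) z - d p_i z] with [z = g p]. Since [g] is an isometry
   and the ends are almost fixed, all the sums [e_i + e_j] are small, hence so
   are the [e_i]. *)
Lemma small_move_of_three_ends (g : G) (p p1 p2 p3 : X) (B : R) :
    gp (act g p) p1 p2 <= B -> gp (act g p) p1 p3 <= B ->
    gp (act g p) p2 p3 <= B ->
    B + 5 * delta < gp (act g p) p1 (act g p1) ->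
    B + 5 * delta < gp (act g p) p2 (act g p2) ->
    B + 5 * delta < gp (act g p) p3 (act g p3) ->
    gp p p1 p2 <= 18 * delta ->
  d p (act g p) <= 60 * delta.
Proof.
move=> b12 b13 b23 f1 f2 f3; set z := act g p in b12 b13 b23 f1 f2 f3 *.
have := gp_perturb b12 f1 f2; have := gp_perturb b13 f1 f3.
have := gp_perturb b23 f2 f3; rewrite !gpE !ler_norml !dist_isom // => e23 e13 e12 pp.
have hy : gp p p1 p2 <= 24 * delta by have := delta_ge1; rewrite gpE; lra.
have hz : gp z p1 p2 <= 24 * delta by have := delta_ge1; rewrite gpE; lra.
have : `|d p p2 - d z p2| <= 6 * delta.
  by rewrite ler_norml; apply/andP; split; lra.
by move=> /(near_line_close hyp hy hz); have := delta_ge1; lra.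
Qed.

Variables (b : G) (o : X).
Local Notation t n := (d o (act (b ^+ n)%g o)).
Hypothesis b_straight : gp o (act b^-1%g o) (act b o) <= 7 * delta.
Hypothesis b_long : 1000 * delta <= t 1.
Variables (p : X) (M m : nat).
Hypothesis p_between : d o p + d p (act b o) = t 1.
Hypothesis p_few : few_movers act M (200 * delta) p.
Hypothesis m_large : (10 * (M + 100) <= m)%N.

Let ge_add := dist_expg_ge_add act_action act_isom hyp delta_ge1 b_straight b_long.

(** The [M + 1] elements [f i] move [b^20 p], which has few movers because [p] does, by at most
    [110 * delta]. Two of them therefore coincide, and [f i = f j] rearranges to the relation with
    [k = j - i]. *)
Lemma commute_of_follow (c g : G) :
    (forall n, d o (act (c ^+ n)%g o) = t n) -> d o (act g o) <= 8 * t 1 ->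
    (M + 80)%:R * t 1 <= gp o (act (c ^+ m)%g o) (act g (act (b ^+ m)%g o)) ->
  exists2 k, (0 < k)%N & (g * b ^+ k = c ^+ k * g)%g.
Proof.
move=> ct gl gf; have d1 := delta_ge1.
pose f i := ((g * b ^+ i)^-1 * (c ^+ i * g))%g.
have [|i [j [ij jM]]] := few_movers_collision (f := f)
    (few_movers_act (g := (b ^+ 20)%g) p_few).
  move=> i iM.
  have fc := follow_commute act_action act_isom hyp delta_ge1 b_straight b_long
    p_between ct m_large gl gf iM.
  rewrite /f (actM act_action (_^-1)%g) -(dist_isom act_isom (g * b ^+ i)%g).
  rewrite actKV // (actM act_action g) (actM act_action (c ^+ i)%g).
  by rewrite -(actM act_action (b ^+ i)%g) -expgnDr; lra.
rewrite /f => E.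
exists (j - i)%N; first by rewrite subn_gt0.
rewrite -(subnK (ltnW ij)) !expgnDr !invgM -!mulgA in E.
move/mulgI: E; rewrite !mulgA => /mulIg /mulIg /(congr1 (fun x => g * (b ^+ (j - i) * x)))%g.
by rewrite -mulgA mulVKg mulVKg => <-; rewrite mulgA mulgVK.
Qed.

End Rigidity.

(** When [b] has a quasi-axis, such a [g] preserves its pair of ends, as in the elementary closure
    of a loxodromic element. *)
Definition coarsely_normalizes (G : groupType) (b g : G) :=
  exists2 k, (0 < k)%N &
    (g * b ^+ k = b ^+ k * g)%g \/ (g * b ^+ k = b^-1 ^+ k * g)%g.

(** * The elementary closure stays near the axis *)

Section ElementaryClosure.
Context (R : realType) (G : groupType) (X : metricType R) (act : G -> X -> X).
Hypothesis act_action : is_action act.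
Hypothesis act_isom : isometric_action act.
Context (delta : R).
Hypothesis hyp : forall w x y z : X,
  Num.min (gp w x y) (gp w y z) - delta <= gp w x z.
Hypothesis delta_ge1 : 1 <= delta.
Variables (b : G) (o : X).
Local Notation t n := (d o (act (b ^+ n)%g o)).
Hypothesis b_straight : gp o (act b^-1%g o) (act b o) <= 7 * delta.
Hypothesis b_long : 1000 * delta <= t 1.

Let ge_add := dist_expg_ge_add act_action act_isom hyp delta_ge1 b_straight b_long.

Lemma dist_expgV n : d o (act (b^-1 ^+ n)%g o) = t n.
Proof. by rewrite expVgn dist_expVg. Qed.

Lemma dist_expg_unbounded (C : R) : exists N, forall n, (N <= n)%N -> C <= t n.
Proof.
exists (Num.truncn `|C|).+1 => n Nn.
have := dist_expg_ge act_action act_isom hyp delta_ge1 b_straight b_long n.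
apply: le_trans; apply: le_trans (ler_norm C) _.
have l2 : 2 <= t 1 by have := delta_ge1; have := b_long; lra.
apply: le_trans (ltW (truncnS_gt _)) _.
have : (Num.truncn `|C|).+1%:R <= n%:R :> R by rewrite ler_nat.
move/le_trans; apply; rewrite ler_peMr // ?ler0n //; lra.
Qed.

(** As [g] conjugates [b^N] to [c^N], it almost fixes or exchanges the directions of the far points
    [b^N o] and [b^-N o], so [g o] lies near the segment joining them and hence within about a
    period of the orbit of [b]. *)
Lemma coarsely_normalizes_near_axis g : coarsely_normalizes b g ->
  exists n, d (act g o) (act (b ^+ n)%g o) <= t 1 + 40 * delta \/
            d (act g o) (act (b^-1 ^+ n)%g o) <= t 1 + 40 * delta.
Proof.
move=> [k k0 cg]; have d1 := delta_ge1; have bl := b_long.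
have [N0 N0P] := dist_expg_unbounded (d o (act g o) + 20 * delta).
set N := (k * N0)%N; have NP : d o (act g o) + 20 * delta <= t N.
  by apply: N0P; rewrite leq_pmull.
have [c cE cg'] : exists2 c, c = b \/ c = b^-1%g & (g * b ^+ N = c ^+ N * g)%g.
  have cN c : (g * b ^+ k = c ^+ k * g)%g -> (g * b ^+ N = c ^+ N * g)%g.
    rewrite /N !expgnA => E; elim: {N NP N0P} N0 => [|n IH].
      by rewrite !expg0 mulg1 mul1g.
    by rewrite !expgSr mulgA IH -mulgA E mulgA.
  by case: cg => /cN E; [exists b; [left|]|exists b^-1%g; [right|]].
have cgV : (g * (b ^+ N)^-1 = (c ^+ N)^-1 * g)%g.
  by apply: (canLR (mulgK _)); rewrite -mulgA cg' mulKg.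
set z := act g o; set P := act (b ^+ N)%g o; set Q := act (b ^+ N)^-1%g o.
have QP : gp z Q P <= 11 * delta.
  have h1 : gp z (act g Q) (act g P) <= 9 * delta.
    rewrite gp_act // gpE dist_expg_expVg // dist_expVg //.
    by have := ge_add N N; lra.
  have h2 h : d z (act g (act h o)) = d o (act h o) by rewrite dist_isom.
  have far (h h' : G) : (g * h = h' * g)%g -> d o (act h o) = t N ->
      9 * delta + 5 * delta < gp z (act g (act h o)) (act h' o).
    move=> hh ht; have := gp_ge z (act g (act h o)) (act h' o).
    rewrite h2 -actM // hh actM // dist_isom // ht (distC (act g o)); lra.
  have tV : d o (act (b ^+ N)^-1%g o) = t N by exact: dist_expVg.
  have f1 := far _ _ cgV tV; have f2 := far _ _ cg' erefl.
  have := gp_perturb hyp delta_ge1 h1 f1 f2; rewrite ler_norml => /andP[_].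
  rewrite /Q /P; case: cE => ->; last rewrite expVgn invgK gpC; lra.
pose y j := act (b ^+ j)%g Q.
have yP : y (N + N)%N = P.
  by rewrite /y /Q -actM // expgnDr mulgK.
have y0 : y 0%N = Q by rewrite /y expg0 act1.
have ex : exists j, gp z Q (y j) <= 12 * delta.
  by exists (N + N)%N; rewrite yP; lra.
(* The condition says that [z] is near the segment from [Q] to [y j]. If the least such [j] is
   positive, [z] is not near the segment from [Q] to the preceding point, hence near the one from
   that point to [P]; this locates [z] within about a period. *)
pose left j := `[< gp z Q (y j) <= 12 * delta >].
have exl : exists j, left j by case: ex => j h; exists j; apply/asboolP.
case: (ex_minnP exl) => j /asboolP lj jmin.
have jNN : (j <= N + N)%N by apply: jmin; apply/asboolP; rewrite yP; lra.
have near : d z (y j) <= t 1 + 40 * delta.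
  case: j lj jmin jNN => [|j] lj jmin jNN.
    rewrite y0 in lj *; move: lj; rewrite gpE distxx.
    have := dist_ge0 o (act (b ^+ 1)%g o); lra.
  have nl : 12 * delta < gp z Q (y j).
    rewrite ltNge; apply/negP => /asboolP h.
    by have := jmin j h; rewrite ltnn.
  have rj : gp z (y j) P <= 12 * delta.
    by have [h|h] := gp_hyp hyp z Q (y j) P; lra.
  have rj' : gp z (y j.+1) P <= 12 * delta + t 1.
    have := gp_dist z (y j.+1) (y j) P.
    have := dist_expg act_action act_isom b Q j 1.
    rewrite addn1 -/(y j) -/(y j.+1) distC => ->.
    have : d Q (act (b ^+ 1)%g Q) = t 1.
      rewrite /Q expg1 -!actM // -(dist_isom act_isom (b ^+ N)%g).
      by rewrite -!actM // mulgV act1 // mulgA -expgSr expgS mulgK.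
    by move=> ->; lra.
  have nj : gp (y j.+1) Q P <= 9 * delta.
    have E1 : d (y j.+1) Q = t j.+1.
      rewrite /y /Q -actM // -(dist_isom act_isom (b ^+ N)%g) -!actM //.
      by rewrite mulgV act1 // mulgA -expgnDr addnC expgnDr mulgK distC.
    have E2 : d (y j.+1) P = t (N + N - j.+1)%N.
      rewrite -yP /y -{1}(subnKC jNN) (expgnDr b j.+1) actM // dist_isom //.
      rewrite /Q -(dist_isom act_isom (b ^+ N)%g) -!actM // mulgV act1 //.
      by rewrite -expgnDr addnC expgnDr mulgK.
    have E3 : d Q P = t (N + N)%N by exact: dist_expg_expVg.
    rewrite gpE E1 E2 E3; have := ge_add j.+1 (N + N - j.+1)%N.
    by rewrite subnKC //; lra.
  move: lj rj' nj; rewrite !gpE (distC Q (y _)).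
  by have := dist_triangle Q z P; rewrite (distC Q z); lra.
case: (leqP N j) => [Nj|/ltnW jN].
  exists (j - N)%N; left; apply: le_trans near.
  by rewrite /y /Q -actM // -{2}(subnK Nj) expgnDr mulgK.
exists (N - j)%N; right; apply: le_trans near.
by rewrite /y /Q -actM // -{2}(subnK jN) expgnDr invgM mulVKg expVgn.
Qed.

End ElementaryClosure.

(** * The coarse normaliser is a subgroup *)

Section CoarseNormalizer.
Context (G : groupType) (b : G).

Lemma coarsely_normalizesE g : coarsely_normalizes b g <->
  exists (k : nat) (e : bool), (0 < k)%N /\
    ((b ^+ k) ^ (g^-1) = (if e then b ^+ k else b ^- k))%g.
Proof.
split=> [[k k0 gE]|[k [e [k0 gE]]]].
  exists k; case: gE => gE; [exists true|exists false]; split => //;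
    by rewrite conjgE invgK mulgA gE mulgK ?expVgn.
exists k => //; have {}gE : (g * b ^+ k = (if e then b ^+ k else b ^- k) * g)%g.
  by rewrite -gE conjgE invgK -!mulgA mulVg mulg1.
by case: e gE; [left|right; rewrite expVgn].
Qed.

Lemma coarsely_normalizes_subgroup : is_subgroup (coarsely_normalizes b).
Proof.
split=> [|g h /coarsely_normalizesE[k [e [k0 gE]]]
    /coarsely_normalizesE[l [f [l0 hE]]]|g /coarsely_normalizesE[k [e [k0 gE]]]].
- by exists 1%N => //; left; rewrite mul1g mulg1.
(* The exponent [l * k] serves both relations, and [e == f] is the product of the two signs. *)
- apply/coarsely_normalizesE; exists (l * k)%N, (e == f).
  rewrite muln_gt0 l0; split => //.
  rewrite invgM conjgM expgnA conjXg hE.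
  have gEl : ((b ^+ (l * k)) ^ g^-1 = if e then b ^+ (l * k) else b ^- (l * k))%g.
    by rewrite mulnC expgnA conjXg gE; case: (e); rewrite ?expVgn.
  case: f {hE}; rewrite ?expVgn ?conjVg -!expgnA gEl; case: (e) => //=.
  by rewrite invgK.
- apply/coarsely_normalizesE; exists k, e; split => //.
  move/(congr1 (fun x => x ^ g)%g): gE; rewrite -conjgM mulVg conjg1 invgK.
  case: (e) => E; first exact: esym.
  by rewrite [in RHS]E conjVg invgK.
Qed.

End CoarseNormalizer.

(** * Elements transverse to the axis *)

Section TransverseElements.
Context (R : realType) (G : groupType) (X : metricType R) (act : G -> X -> X).
Hypothesis act_action : is_action act.
Hypothesis act_isom : isometric_action act.
Context (delta : R).
Hypothesis hyp : forall w x y z : X,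
  Num.min (gp w x y) (gp w y z) - delta <= gp w x z.
Hypothesis delta_ge1 : 1 <= delta.
Variables (b : G) (o : X).
Local Notation t n := (d o (act (b ^+ n)%g o)).
Hypothesis b_straight : gp o (act b^-1%g o) (act b o) <= 7 * delta.
Hypothesis b_long : 1000 * delta <= t 1.
Variables (p : X) (M m : nat).
Hypothesis p_between : d o p + d p (act b o) = t 1.
Hypothesis p_few : few_movers act M (200 * delta) p.
Hypothesis m_large : (10 * (M + 100) <= m)%N.
Variable h : G.
Hypothesis h_transverse : ~ coarsely_normalizes b h.
Hypothesis h_le : d o (act h o) <= 8 * t 1.

Let ge_add := dist_expg_ge_add act_action act_isom hyp delta_ge1 b_straight b_long.

Lemma dist_expg_m_ge : 2 * (M%:R * t 1) + 200 * t 1 <= t m.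
Proof.
have := dist_expg_ge act_action act_isom hyp delta_ge1 b_straight b_long m.
have : (4 * M + 400)%:R * t 1 <= m%:R * t 1.
  by rewrite ler_wpM2r ?dist_ge0 // ler_nat; move: m_large; clear; lia.
by rewrite natrD natrM; lra.
Qed.

Lemma transverse_gp_lt c : c = b \/ c = b^-1%g ->
  gp o (act (c ^+ m)%g o) (act h (act (b ^+ m)%g o)) < (M + 80)%:R * t 1.
Proof.
move=> cE; rewrite ltNge; apply/negP => far; apply: h_transverse.
have ct n : d o (act (c ^+ n)%g o) = t n by case: cE => -> //; rewrite dist_expgV.
have [k k0 kE] := commute_of_follow act_action act_isom hyp delta_ge1 b_straight
  b_long p_between p_few m_large ct h_le far.
by exists k => //; case: cE kE => ->; [left|right].
Qed.

(** From exponent [m] on, the powers keep their direction seen from [o], so the bound of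
    [transverse_gp_lt] persists up to two [delta]. *)
Lemma transverse_gp_le c n : c = b \/ c = b^-1%g -> (m <= n)%N ->
  gp o (act (c ^+ n)%g o) (act h (act (b ^+ n)%g o)) <=
    (M + 80)%:R * t 1 + 2 * delta.
Proof.
move=> cE mn; have d1 := delta_ge1; have bl := b_long; have hl := h_le.
have lt := ltW (transverse_gp_lt cE).
have tm := dist_expg_m_ge; rewrite natrD mulrDl in lt *.
have tmn := ge_add m (n - m); rewrite subnKC // in tmn.
have A0 : 0 <= M%:R * t 1 by rewrite mulr_ge0 // dist_ge0.
have far (e : G) : (forall j, d o (act (e ^+ j)%g o) = t j) ->
    t m - 9 * delta <= gp o (act (e ^+ m)%g o) (act (e ^+ n)%g o).
  by move=> et; rewrite gpE -{2}(subnKC mn) dist_expg // !et; lra.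
have ct j : d o (act (c ^+ j)%g o) = t j by case: cE => -> //; rewrite dist_expgV.
have f1 := far c ct; have f2 := far b (fun=> erefl).
have f3 : t m - 9 * delta - 8 * t 1 <=
    gp o (act h (act (b ^+ m)%g o)) (act h (act (b ^+ n)%g o)).
  have := gp_base (act h o) o (act h (act (b ^+ m)%g o)) (act h (act (b ^+ n)%g o)).
  by rewrite gp_act // (distC (act h o)); lra.
have [k|k] := gp_hyp hyp o (act (c ^+ m)%g o) (act (c ^+ n)%g o) (act h (act (b ^+ m)%g o));
have [k'|k'] := gp_hyp hyp o (act (c ^+ n)%g o) (act h (act (b ^+ n)%g o))
  (act h (act (b ^+ m)%g o));
have := gpC o (act h (act (b ^+ m)%g o)) (act h (act (b ^+ n)%g o));
by lra.
Qed.

(** Commuting with powers of [b] and of [h b h^-1], [f] moves [b^-n o], [b^n o] and [h b^n o] by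
    amounts independent of the chosen multiple [n] of [k * l]. For large [n] these are three
    separated, almost fixed ends, and [small_move_of_three_ends] applies. *)
Lemma small_move_of_commute (f : G) (k l : nat) : (0 < k)%N -> (0 < l)%N ->
    commute f (b ^+ k)%g -> commute (h^-1 * f * h)%g (b ^+ l)%g ->
  d p (act f p) <= 60 * delta.
Proof.
move=> k0 l0 fk fl; have d1 := delta_ge1; have bl := b_long; have hl := h_le.
set f' := (h^-1 * f * h)%g in fl.
pose B := (M + 80)%:R * t 1 + 2 * delta + d o (act f p).
have [N0 N0P] := dist_expg_unbounded act_action act_isom hyp delta_ge1 b_straight
  b_long (B + 6 * delta + d o (act f p) + 8 * t 1 + d o (act f o) + d o (act f' o)).
(* Divisible by [k] and [l] for the commutations, at least [m] for [transverse_gp_le], and large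
   through [N0]. *)
pose n := (k * l * (N0 + m))%N.
have mn : (m <= n)%N.
  by rewrite /n (leq_trans (leq_addl N0 m)) // leq_pmull // muln_gt0 k0.
have nP := N0P n; have {}nP := nP (leq_trans (leq_addr m N0) (leq_pmull _ _)).
have {}nP : B + 6 * delta + d o (act f p) + 8 * t 1 + d o (act f o) +
  d o (act f' o) <= t n by apply: nP; rewrite muln_gt0 k0.
have f0 := dist_ge0 o (act f o); have f'0 := dist_ge0 o (act f' o).
have t0 := dist_ge0 o (act (b ^+ 1)%g o).
have fn : commute f (b ^+ n)%g by rewrite /n -mulnA expgnA; exact: commuteX.
have f'n : commute f' (b ^+ n)%g.
  by rewrite /n -mulnA mulnCA expgnA; exact: commuteX.
have fVn : commute f (b^-1 ^+ n)%g by rewrite expVgn; exact: commuteV.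
have gpz x y (C : R) : gp o x y <= C -> gp (act f p) x y <= C + d o (act f p).
  by have := gp_base (act f p) o x y; rewrite (distC (act f p)); lra.
have far x D : d o x + 8 * t 1 >= t n -> d x (act f x) <= D ->
    D <= d o (act f o) + d o (act f' o) -> B + 5 * delta < gp (act f p) x (act f x).
  move=> ox xfx DD; have := gp_ge (act f p) x (act f x).
  by have := dist_triangle o (act f p) x; lra.
have c1 : d (act (b^-1 ^+ n)%g o) (act f (act (b^-1 ^+ n)%g o)) = d o (act f o).
  by rewrite -actM // fVn actM // dist_isom.
have c2 : d (act (b ^+ n)%g o) (act f (act (b ^+ n)%g o)) = d o (act f o).
  by rewrite -actM // fn actM // dist_isom.
have c3 : d (act h (act (b ^+ n)%g o)) (act f (act h (act (b ^+ n)%g o)))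
    = d o (act f' o).
  have -> : act f (act h (act (b ^+ n)%g o)) = act h (act (b ^+ n)%g (act f' o)).
    by rewrite -!actM // -!mulgA -f'n /f' !mulgA mulgV mul1g.
  by rewrite !dist_isom.
have n0 : (0 < n)%N by apply: leq_trans mn; move: m_large; clear; lia.
apply: (@small_move_of_three_ends _ _ _ _ act_isom delta hyp delta_ge1 f p
  (act (b^-1 ^+ n)%g o) (act (b ^+ n)%g o) (act h (act (b ^+ n)%g o)) B).
- rewrite /B; apply: gpz; rewrite gpE dist_expgV // expVgn dist_expg_expVg //.
  have := ge_add n n; have : 0 <= (M + 80)%:R * t 1 by rewrite mulr_ge0 // dist_ge0.
  have : 20 * (t 1) <= (M + 80)%:R * t 1.
    by rewrite ler_wpM2r ?dist_ge0 // ler_nat (leq_trans _ (leq_addl M 80)).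
  lra.
- by rewrite /B; apply: gpz; apply: transverse_gp_le => //; right.
- by rewrite /B; apply: gpz; apply: transverse_gp_le => //; left.
- by apply: far (eq_ind_r (fun x => x <= _) (lexx _) c1) _; [rewrite dist_expgV //; lra|lra].
- by apply: far (eq_ind_r (fun x => x <= _) (lexx _) c2) _; lra.
- apply: far (eq_ind_r (fun x => x <= _) (lexx _) c3) _; last lra.
  have := dist_triangle (act h o) o (act h (act (b ^+ n)%g o)).
  by rewrite dist_isom // (distC (act h o)); lra.
- rewrite expVgn; exact: (gp_between_expg act_action act_isom hyp delta_ge1
    b_straight b_long p_between n0).
Qed.

End TransverseElements.

(** * Thick points and horoballs *)

Section Topology.
Context (R : realType) (G : groupType) (X : metricType R) (act : G -> X -> X).
Hypothesis act_action : is_action act.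
Hypothesis act_isom : isometric_action act.

Lemma open_dist (U : set X) (x : X) : open U -> U x ->
  exists2 e : R, 0 < e & forall y, d x y < e -> U y.
Proof.
move=> oU Ux; have : nbhs x U by apply: open_nbhs_nbhs.
move=> /nbhs_ballP[e /= e0 eU]; exists e => // y xy; apply: eU.
by rewrite ballEmdist.
Qed.

Lemma compact_bounded_dist (K : set X) (x : X) : compact K ->
  exists C : R, forall y, K y -> d x y <= C.
Proof.
move=> /compact_near_coveringP/(_ nat \oo (fun n y => d x y <= n%:R)).
case=> [y Ky|N _ NP]; last by exists N%:R => y Ky; exact: (NP N (leqnn N)).
exists ([set z | d y z < 1], [set n | d x y + 1 <= n%:R]) => /=; last first.
  by move=> [z n] /= [yz xn]; have := dist_triangle x y z; lra.
split; first by apply/nbhs_ballP; exists 1 => //= z; rewrite ballEmdist.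
exists (Num.truncn (d x y)).+2 => // n /= Nn.
apply: (@le_trans _ _ (Num.truncn (d x y)).+2%:R); last by rewrite ler_nat.
by rewrite -[in leRHS]natr1 lerD2r ltW // truncnS_gt.
Qed.

Hypothesis geod : geodesic_space X.
Variable UU : set (set X).
Hypothesis UU_open : forall U, UU U -> open U.
Hypothesis UU_act : forall g U, UU U -> UU (act g @` U).
Hypothesis UU_triv : trivIset UU id.
Local Notation thick := (~` \bigcup_(U in UU) U).

Lemma UU_eq U V x : UU U -> UU V -> U x -> V x -> U = V.
Proof. by move=> UU1 UV Ux Vx; apply: UU_triv => //; exists x. Qed.

(** Connectedness: a geodesic without thick points is covered by disjoint open horoballs, and the
    supremum of the times spent in the horoball of [x] can only be the final time. *)
Lemma geodesic_thick_or_same x y :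
  (exists2 p, thick p & d x p + d p y = d x y) \/
  (exists U, [/\ UU U, U x & U y]).
Proof.
have [c [c0 c1 cE]] := geod x y.
have cEd s t : 0 <= s <= d x y -> 0 <= t <= d x y -> d (c s) (c t) = `|s - t|.
  exact: cE.
have i0 : 0 <= (0 : R) <= d x y by rewrite lexx dist_ge0.
have i1 : 0 <= d x y <= d x y by rewrite lexx dist_ge0.
have [[s [si ts]]|no] := pselect (exists s, 0 <= s <= d x y /\ thick (c s)).
  left; exists (c s) => //; have := cEd _ _ i0 si; have := cEd _ _ si i1.
  rewrite c0 c1 => -> ->; rewrite sub0r normrN distrC.
  by case/andP: si => s0 sd; rewrite !ger0_norm ?subr_ge0 //; lra.
right; have cov s : 0 <= s <= d x y -> exists2 U, UU U & U (c s).
  by move=> si; apply: contrapT => nU; apply: no; exists s.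
have [U UUU Ux] := cov 0 i0; rewrite c0 in Ux.
exists U; split => //.
pose E := [set s : R | 0 <= s <= d x y /\ U (c s)].
have E0 : E 0 by split; rewrite // c0.
have supE : has_sup E.
  by split; [exists 0 | exists (d x y) => s [/andP[]]].
have si : 0 <= sup E <= d x y.
  apply/andP; split; first exact: (ub_le_sup supE.2).
  by apply: sup_le_ub => //; [exists 0 | move=> s [/andP[]]].
have [V UV Vs] := cov _ si; have [e e0 eV] := open_dist (UU_open UV) Vs.
have [s [s1 Us] se] := sup_adherent e0 supE.
have ss : s <= sup E by exact: (ub_le_sup supE.2).
have UVE : U = V.
  apply: (UU_eq UUU UV Us); apply: eV; rewrite cEd // ger0_norm; lra.
have [Ed|] := eqVneq (sup E) (d x y); first by rewrite -c1 UVE -/(d x y) -Ed.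
move=> neq; have {neq}lt : sup E < d x y.
  by rewrite lt_neqAle neq; case/andP: si.
pose s' := Num.min (d x y) (sup E + e / 2).
have s'gt : sup E < s' by rewrite lt_min lt; lra.
have s'le : s' <= sup E + e / 2 by rewrite ge_min lexx orbT.
have s'i : 0 <= s' <= d x y by rewrite ge_min lexx andbT; case/andP: si; lra.
have : E s'.
  by split => //; rewrite UVE; apply: eV; rewrite cEd // distrC ger0_norm; lra.
by move/(ub_le_sup supE.2); lra.
Qed.

Lemma thick_between_or_stable x g :
  (exists2 p, thick p & d x p + d p (act g x) = d x (act g x)) \/
  (exists U, [/\ UU U, U x & act g @` U = U]).
Proof.
have [?|[U [UUU Ux Ugx]]] := geodesic_thick_or_same x (act g x); first by left.
right; exists U; split => //; apply: (@UU_eq _ _ (act g x)) => //; first exact: UU_act.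
Qed.

Hypothesis X_proper : proper_space X.
Hypothesis act_proper : proper_action act.
Hypothesis act_cocompact : cocompact_on act thick.

(** Translate the point into the compact [K]. An element moving a point of [K] by at most [r]
    carries some point of the ball of radius [C + r] into that ball, which is compact, so properness
    of the action leaves finitely many. *)
Lemma uniformly_few_movers (r : R) :
  exists M, forall p, thick p -> few_movers act M r p.
Proof.
have [K [cK _ KP]] := act_cocompact.
have [[k Kk]|K0] := pselect (K !=set0); last first.
  exists 0%N => p /KP[g _ [k Kk]]; exfalso; apply: K0; by exists k.
have [C CP] := compact_bounded_dist k cK.
have finF := act_proper (@X_proper k (C + r)).
exists #|` fset_set [set g | (act g @` [set y | mdist k y <= C + r]) `&`
  [set y | mdist k y <= C + r] !=set0] | => p /KP[g _ [q Kq <-]].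
apply: few_movers_act => // s us small.
apply: (@leq_trans #|` [fset g in s]%fset|).
  by rewrite card_fseq undup_id.
apply: fsubset_leq_card; apply/fsubsetP => h; rewrite !inE => hs.
rewrite in_fset_set // inE /=; exists (act h q); split.
  exists q => //=; have := CP _ Kq; have := small _ hs; rewrite -!/(d _ _).
  by have := dist_ge0 q (act h q); lra.
have := CP _ Kq; have := small _ hs; rewrite /= -!/(d _ _).
by have := dist_triangle k q (act h q); lra.
Qed.

End Topology.

(** * Sequences converging to the Gromov boundary *)

Section Boundary.
Context (R : realType) (X : metricType R) (delta : R).
Hypothesis hyp : forall w x y z : X,
  Num.min (gp w x y) (gp w y z) - delta <= gp w x z.
Hypothesis delta_ge0 : 0 <= delta.
Implicit Types u v : nat -> X.

Lemma same_end_sym u v : same_end u v -> same_end v u.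
Proof.
move=> uv w C; have [N NP] := uv w C; exists N => i j Ni Nj.
by rewrite gpC; exact: NP.
Qed.

Lemma same_end_trans u v r : same_end u v -> same_end v r -> same_end u r.
Proof.
move=> uv vr w C; have [N NP] := uv w (C + delta).
have [N' NP'] := vr w (C + delta); exists (maxn N N') => i j.
rewrite !geq_max => /andP[i1 i2] /andP[j1 j2].
have := NP i (maxn N N') i1 (leq_maxl _ _).
have := NP' (maxn N N') j (leq_maxr _ _) j2.
by have [h|h] := gp_hyp hyp w (u i) (v (maxn N N')) (r j); lra.
Qed.

Lemma gromov_boundary_eq xi zeta u v : gromov_boundary xi -> gromov_boundary zeta ->
  xi u -> zeta v -> same_end u v -> xi = zeta.
Proof.
move=> [a ta ->] [b tb ->] [tu au] [tv bv] uv.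
have ab : same_end a b.
  exact: same_end_trans au (same_end_trans uv (same_end_sym bv)).
apply/seteqP; split => r [tr h]; split => //.
  by apply: same_end_trans h; exact: same_end_sym.
exact: same_end_trans ab h.
Qed.

Lemma tends_dist u w (C : R) : tends_to_infinity u ->
  exists N, forall i, (N <= i)%N -> C <= d w (u i).
Proof.
move=> tu; have [N NP] := tu w C; exists N => i Ni.
by have := NP i i Ni Ni; rewrite gpE distxx; lra.
Qed.

(** Late terms of each sequence share a direction, so one late pair with a large product controls
    all later pairs. *)
Lemma same_end_of_frequently u v : tends_to_infinity u -> tends_to_infinity v ->
    (exists w, forall (C : R) N, exists i j,
      [/\ (N <= i)%N, (N <= j)%N & C <= gp w (u i) (v j)]) ->
  same_end u v.
Proof.
have d0 := delta_ge0; move=> tu tv [x fr] w C.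
have [N NP] := tu w (C + 2 * delta); have [N' NP'] := tv w (C + 2 * delta).
have [i [j [+ + ij]]] := fr (C + 2 * delta + d x w) (maxn N N').
rewrite !geq_max => /andP[i1 i2] /andP[j1 j2].
exists (maxn N N') => i' j'; rewrite !geq_max => /andP[i1' i2'] /andP[j1' j2'].
have h1 := NP _ _ i1' i1; have h2 := NP' _ _ j2 j2'.
have h3 := gp_base x w (u i) (v j).
by have [h|h] := gp_hyp hyp w (u i') (u i) (v j');
   have [k|k] := gp_hyp hyp w (u i) (v j) (v j'); lra.
Qed.

End Boundary.

(** * Obstructions from non-elementarity *)

Section NonElementary.
Context (R : realType) (G : groupType) (X : metricType R) (act : G -> X -> X).
Hypothesis act_action : is_action act.
Hypothesis act_isom : isometric_action act.
Context (delta : R).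
Hypothesis hyp : forall w x y z : X,
  Num.min (gp w x y) (gp w y z) - delta <= gp w x z.
Hypothesis delta_ge1 : 1 <= delta.

Let delta_ge0 : 0 <= delta. Proof. exact: le_trans ler01 delta_ge1. Qed.

Lemma limit_setP (H : set G) xi : limit_set act H xi -> exists x h,
  [/\ gromov_boundary xi, tends_to_infinity (fun n => act (h n) x),
      xi (fun n => act (h n) x) & forall n, H (h n)].
Proof.
move=> [bxi [x [h [Hh xih]]]]; exists x, h; split => //.
by case: bxi => u _ E; move: xih; rewrite E => -[].
Qed.

(* Along a sequence tending to the centre, all points of the horoball are
   eventually closer than [x], up to a constant. *)
Lemma horoball_gp (xi : set (nat -> X)) (U : set X) (x : X) :
    parabolic_point act xi -> open_horoball xi U ->
  exists C : R, forall y y', U y -> U y' ->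
    Num.min (d x y) (d x y') / 2 - C <= gp x y y'.
Proof.
move=> [P [_ PE]] [_ [h [[C hC] ->]]].
have [u xiu] : exists u, xi u.
  have : limit_set act P xi by rewrite PE.
  by move=> /limit_setP[y [k [_ _ ? _]]]; exists (fun n => act (k n) y).
exists ((C - h x) / 2 + delta) => y y' /= hy hy'.
have near_gp z : h z < 0 -> \forall n \near \oo, (d x z - (C - h x)) / 2 <= gp x z (u n).
  move=> hz; near=> n.
  have : `|(h z - h x) - (d z (u n) - d x (u n))| <= C.
    by near: n; exact: hC.
  by rewrite ler_norml gpE => /andP[? ?]; lra.
have [n [n1 n2]] := filter_ex (filterI (near_gp y hy) (near_gp y' hy')).
rewrite gpC in n2; rewrite /Num.min; case: ifP => [|/negbT]; rewrite -?leNgt => yy'.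
  by have [k|k] := gp_hyp hyp x y (u n) y'; lra.
by have [k|k] := gp_hyp hyp x y (u n) y'; lra.
Unshelve. all: by end_near.
Qed.

Variable H : set G.
Hypothesis H_ne : non_elementary act H.

(** Otherwise the orbit of [x] under [H] stays in [U]; by [horoball_gp] all its sequences tending to
    infinity have the same limit, so [H] has at most one limit point. *)
Lemma non_elementary_not_stable (xi : set (nat -> X)) (U : set X) (x : X) :
  parabolic_point act xi -> open_horoball xi U -> U x ->
  ~ (forall h, H h -> act h @` U = U).
Proof.
move=> pxi hU Ux HU; have [C CP] := horoball_gp x pxi hU.
have [xi1 [xi2 [_ [L1 L2 _ [ne _ _]]]]] := H_ne.
have [x1 [h1 [b1 t1 u1 H1]]] := limit_setP L1.
have [x2 [h2 [b2 t2 u2 H2]]] := limit_setP L2.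
apply: ne; apply: (gromov_boundary_eq hyp b1 b2 u1 u2).
apply: (same_end_of_frequently hyp delta_ge0 t1 t2); exists x => D N.
have [N1 N1P] := tends_dist x (2 * (D + C + d x1 x + d x2 x) + d x1 x) t1.
have [N2 N2P] := tends_dist x (2 * (D + C + d x1 x + d x2 x) + d x2 x) t2.
exists (maxn N N1), (maxn N N2); rewrite !leq_maxl; split => //.
set i := maxn N N1; set j := maxn N N2.
have Ui h : H h -> U (act h x) by move=> /HU <-; exists x.
have := CP _ _ (Ui _ (H1 i)) (Ui _ (H2 j)).
have := N1P i (leq_maxr _ _); have := N2P j (leq_maxr _ _).
have := dist_triangle x (act (h1 i) x) (act (h1 i) x1).
have := dist_triangle x (act (h2 j) x) (act (h2 j) x2).
rewrite !dist_isom // !(distC x x1) !(distC x x2).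
have := gp_dist x (act (h1 i) x) (act (h1 i) x1) (act (h2 j) x).
have := gp_dist x (act (h2 j) x) (act (h2 j) x2) (act (h1 i) x1).
rewrite !dist_isom // !(distC x x1) !(distC x x2) !(gpC x (act (h2 j) _)).
by rewrite /Num.min; case: ifP; lra.
Qed.

Lemma non_elementary_infinite (s : seq G) : ~ (forall h, H h -> h \in s).
Proof.
move=> Hs; have [xi1 [_ [_ [L1 _ _ _]]]] := H_ne.
have [x [h [_ th _ Hh]]] := limit_setP L1.
have [N NP] := tends_dist x (\sum_(g <- s) d x (act g x) + 1) th.
have := NP N (leqnn N); have := Hs _ (Hh N); move: (h N) => g gs.
by rewrite (big_rem g gs) /=; have : 0 <= \sum_(y <- rem g s) d x (act y x);
  [apply: sumr_ge0 => ? _; exact: dist_ge0 | lra].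
Qed.

Variables (b : G) (o : X).
Local Notation t n := (d o (act (b ^+ n)%g o)).
Hypothesis b_straight : gp o (act b^-1%g o) (act b o) <= 7 * delta.
Hypothesis b_long : 1000 * delta <= t 1.

Let ge_add := dist_expg_ge_add act_action act_isom hyp delta_ge1 b_straight b_long.

Lemma gp_expg_ge c i j : c = b \/ c = b^-1%g ->
  Num.min (t i) (t j) - 9 * delta <= gp o (act (c ^+ i)%g o) (act (c ^+ j)%g o).
Proof.
move=> cE; have ct n : d o (act (c ^+ n)%g o) = t n.
  by case: cE => -> //; rewrite dist_expgV.
have le k l : (k <= l)%N ->
    t k - 9 * delta <= gp o (act (c ^+ k)%g o) (act (c ^+ l)%g o).
  move=> kl; rewrite gpE -{2}(subnKC kl) dist_expg // !ct.
  by have := ge_add k (l - k); rewrite subnKC //; lra.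
have [ij|/ltnW ij] := leqP i j.
  by apply: le_trans (le _ _ ij); rewrite lerB // ge_min lexx.
by rewrite gpC; apply: le_trans (le _ _ ij); rewrite lerB // ge_min lexx orbT.
Qed.

(** An orbit near the quasi-axis accumulates only at its two ends, so two of three limit points
    would agree. [side e h] records that the sequence is near the half-axis [e] infinitely often. *)
Lemma non_elementary_not_near_axis (D : R) :
  ~ (forall h, H h -> exists n, d (act h o) (act (b ^+ n)%g o) <= D \/
       d (act h o) (act (b^-1 ^+ n)%g o) <= D).
Proof.
move=> near; have [xi1 [xi2 [xi3 [L1 L2 L3 [n12 n13 n23]]]]] := H_ne.
pose c (e : bool) := if e then b else (b^-1)%g.
pose side e (h : nat -> G) := forall N, exists n, (N <= n)%N /\
  exists k, d (act (h n) o) (act (c e ^+ k)%g o) <= D.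
have sides (h : nat -> G) : (forall n, H (h n)) -> exists e, side e h.
  move=> Hh; have [st|nst] := pselect (side true h); first by exists true.
  exists false => N; move/existsNP: nst => [N1 nN1].
  exists (maxn N N1); split; first exact: leq_maxl.
  have [k [kD|kD]] := near _ (Hh (maxn N N1)); last by exists k.
  exfalso; apply: nN1; exists (maxn N N1); split; first exact: leq_maxr.
  by exists k.
have same xi zeta e x y h g : gromov_boundary xi -> gromov_boundary zeta ->
    tends_to_infinity (fun n => act (h n) x) ->
    tends_to_infinity (fun n => act (g n) y) ->
    xi (fun n => act (h n) x) -> zeta (fun n => act (g n) y) ->
    side e h -> side e g -> xi = zeta.
  move=> bxi bz th tg xih zg sh sg.
  apply: (gromov_boundary_eq hyp bxi bz xih zg).
  apply: (same_end_of_frequently hyp delta_ge0 th tg); exists o => C N.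
  pose C' := C + 9 * delta + 3 * (D + d o x + d o y).
  have [N1 N1P] := tends_dist o C' th.
  have [N2 N2P] := tends_dist o C' tg.
  have [i [iN [k kD]]] := sh (maxn N N1); have [j [jN [l lD]]] := sg (maxn N N2).
  move: iN jN; rewrite !geq_max => /andP[i1 i2] /andP[j1 j2].
  exists i, j; split => //.
  have cE : c e = b \/ c e = (b^-1)%g by case: (e); [left|right].
  have ct n : d o (act (c e ^+ n)%g o) = t n.
    by case: cE => -> //; rewrite dist_expgV.
  have a1 := N1P _ i2; have a2 := N2P _ j2.
  have a3 := dist_triangle o (act (h i) o) (act (h i) x).
  have a4 := dist_triangle o (act (g j) o) (act (g j) y).
  have a5 := dist_triangle o (act (c e ^+ k)%g o) (act (h i) o).
  have a6 := dist_triangle o (act (c e ^+ l)%g o) (act (g j) o).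
  rewrite !dist_isom // in a3 a4; rewrite !ct in a5 a6.
  have a7 := dist_triangle (act (c e ^+ k)%g o) (act (h i) o) (act (h i) x).
  have a8 := dist_triangle (act (c e ^+ l)%g o) (act (g j) o) (act (g j) y).
  rewrite (dist_isom act_isom (h i)) in a7.
  rewrite (dist_isom act_isom (g j)) in a8.
  have a9 := gp_dist o (act (c e ^+ k)%g o) (act (h i) x) (act (c e ^+ l)%g o).
  have a10 := gp_dist o (act (c e ^+ l)%g o) (act (g j) y) (act (h i) x).
  rewrite gpC (gpC o (act (g j) y)) in a10.
  rewrite distC in kD; rewrite distC in lD.
  have := gp_expg_ge k l cE; rewrite /C' in a1 a2.
  have x0 := dist_ge0 o x; have y0 := dist_ge0 o y.
  have D0 : 0 <= D by apply: le_trans kD; exact: dist_ge0.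
  by rewrite /Num.min; case: ifP => _; lra.
have [x1 [h1 [b1 t1 u1 /sides[e1 s1]]]] := limit_setP L1.
have [x2 [h2 [b2 t2 u2 /sides[e2 s2]]]] := limit_setP L2.
have [x3 [h3 [b3 t3 u3 /sides[e3 s3]]]] := limit_setP L3.
have [e12|/eqP e12] := eqVneq e1 e2.
  by rewrite -e12 in s2; exact: n12 (same _ _ _ _ _ _ _ b1 b2 t1 t2 u1 u2 s1 s2).
have [e13|/eqP e13] := eqVneq e1 e3.
  by rewrite -e13 in s3; exact: n13 (same _ _ _ _ _ _ _ b1 b3 t1 t3 u1 u3 s1 s3).
have e23 : e2 = e3 by move: e12 e13; clear; case: e1; case: e2; case: e3.
by rewrite -e23 in s3; exact: n23 (same _ _ _ _ _ _ _ b2 b3 t2 t3 u2 u3 s2 s3).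
Qed.

(** A stable [U] would contain [b^N o] and [b^-N o]; [horoball_gp] makes their Gromov product grow
    with [N], whereas straightness keeps it at most [9 * delta]. *)
Lemma straight_not_stable (xi : set (nat -> X)) (U : set X) :
  parabolic_point act xi -> open_horoball xi U -> U o -> act b @` U <> U.
Proof.
move=> pxi hU Uo bU; have [C CP] := horoball_gp o pxi hU.
have Un n : U (act (b ^+ n)%g o).
  elim: n => [|n IH]; first by rewrite expg0 act1.
  by rewrite expgS actM // -bU; exists (act (b ^+ n)%g o).
have UVn n : U (act (b ^+ n)^-1%g o).
  elim: n => [|n IH]; first by rewrite expg0 invg1 act1.
  rewrite expgSr invgM actM //; move: IH; rewrite -{1}bU => -[y Uy <-].
  by rewrite actK.
have [N NP] := dist_expg_unbounded act_action act_isom hyp delta_ge1 b_straight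
  b_long (2 * (C + 10 * delta)).
have := CP _ _ (UVn N) (Un N); have := NP N (leqnn N); have := ge_add N N.
rewrite gpE dist_expg_expVg // dist_expVg // /Num.min ltxx.
by have := delta_ge1; lra.
Qed.

End NonElementary.

(** * Packings and coverings for a reflexive symmetric relation *)

Section Packing.
Context (T : eqType) (r : rel T).
Hypothesis r_refl : reflexive r.
Hypothesis r_sym : symmetric r.

Lemma maximal_packing (s : seq T) : uniq s -> exists u, [/\ uniq u,
  {subset u <= s}, {in u &, forall x y, x != y -> ~~ r x y} &
  forall x, x \in s -> has (r x) u].
Proof.
elim: s => [|x s IH] /=; first by exists [::].
move=> /andP[xs us]; have [u [uu sub pack cov]] := IH us.
have [hx|hx] := boolP (has (r x) u).
  exists u; split => // [y /sub yu|y]; first by rewrite inE yu orbT.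
  by rewrite inE => /predU1P[->|/cov].
exists (x :: u); split.
- by rewrite /= uu andbT; apply: contra xs => /sub.
- by move=> y; rewrite !inE => /predU1P[->|/sub ->]; rewrite ?eqxx ?orbT.
- move=> y z; rewrite !inE => /predU1P[->|yu] /predU1P[->|zu].
  + by rewrite eqxx.
  + by move=> _; exact: (hasPn hx).
  + by move=> _; rewrite r_sym; exact: (hasPn hx).
  + exact: pack.
- by move=> y; rewrite inE /= => /predU1P[->|/cov ->]; rewrite ?r_refl ?orbT.
Qed.

Lemma size_le_cover (s u : seq T) (q : nat) : (forall x, x \in s -> has (r x) u) ->
  {in u, forall y, (count (r y) s <= q)%N} -> (size s <= q * size u)%N.
Proof.
elim: u s => [|y u IH] s cov small.
  by case: s cov {small} => // x s /(_ x (mem_head _ _)).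
rewrite /= mulnS -(count_predC (r y)) leq_add ?small ?mem_head //.
rewrite -size_filter; apply: IH => [x|z zu].
  rewrite mem_filter /= => /andP[yx /cov /=]; rewrite r_sym.
  by rewrite (negbTE yx).
rewrite count_filter; apply: leq_trans (small z _); last by rewrite inE zu orbT.
by apply: sub_count => x /= /andP[].
Qed.

Lemma packing_size_le (s u : seq T) : (forall x, x \in s -> has (r x) u) ->
  s != [::] -> exists2 y, y \in u & (size s <= count (r y) s * size u)%N.
Proof.
case: u => [|z u] cov s0; first by case: s s0 cov => // x s _ /(_ x (mem_head _ _)).
case: (@arg_maxnP _ (@ord0 (size u)) xpredT (fun i => count (r (nth z (z :: u) i)) s) isT)
  => i _ imax.
exists (nth z (z :: u) i); first by rewrite mem_nth //= ltn_ord.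
apply: size_le_cover => // y /(nthP z)[j jlt <-].
exact: (imax (Ordinal jlt) isT).
Qed.

End Packing.

Lemma count_le1 (T : eqType) (P : pred T) (s : seq T) : uniq s ->
  {in s &, forall x y, P x -> P y -> x = y} -> (count P s <= 1)%N.
Proof.
move=> us inj; rewrite -size_filter.
case E : [seq x <- s | P x] => [|x [|y l]] //.
have xf : x \in [seq x <- s | P x] by rewrite E mem_head.
have yf : y \in [seq x <- s | P x] by rewrite E !inE eqxx orbT.
move: xf yf; rewrite !mem_filter => /andP[Px xs] /andP[Py ys].
have := filter_uniq P us; rewrite E /= (inj x y xs ys Px Py).
by rewrite mem_head.
Qed.

Definition is_word (G : groupType) (A : set G) (n : nat) (g : G) :=
  exists w : seq G, [/\ (size w <= n)%N, forall s, s \in w -> A s &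
    (\prod_(s <- w) s)%g = g].

(** * Words of bounded length *)

Section Words.
Context (G : groupType) (A : set G).

Lemma is_word1 n : is_word A n 1%g.
Proof. by exists [::]; rewrite big_nil. Qed.

Lemma is_word_gen a : A a -> is_word A 1 a.
Proof. by exists [:: a]; rewrite big_seq1; split => // s; rewrite inE => /eqP->. Qed.

Lemma is_word_leq m n g : (m <= n)%N -> is_word A m g -> is_word A n g.
Proof. by move=> mn [w [sw Aw E]]; exists w; split => //; exact: leq_trans mn. Qed.

Lemma is_wordM m n g h :
  is_word A m g -> is_word A n h -> is_word A (m + n) (g * h)%g.
Proof.
move=> [w [sw Aw <-]] [v [sv Av <-]]; exists (w ++ v).
rewrite size_cat leq_add // big_cat; split => // s.
by rewrite mem_cat => /orP[/Aw|/Av].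
Qed.

Lemma is_word_prod n (w : seq G) : (forall s, s \in w -> is_word A n s) ->
  is_word A (size w * n) (\prod_(s <- w) s)%g.
Proof.
elim: w => [|s w IH] Aw; first by rewrite big_nil; exact: is_word1.
rewrite big_cons mulSn; apply: is_wordM; first by apply: Aw; rewrite mem_head.
by apply: IH => r rw; apply: Aw; rewrite inE rw orbT.
Qed.

Lemma is_word_expg m n g : is_word A m g -> is_word A (n * m) (g ^+ n)%g.
Proof.
move=> Ag; have := @is_word_prod m (nseq n g); rewrite size_nseq big_nseq iter_mulg_1.
by apply => s; rewrite mem_nseq => /andP[_ /eqP->].
Qed.

End Words.

(** Comparing words of equal length suffices for counting: there are [size V ^ n] products of [n]
    elements. *)
Definition freely_multiplies (G : groupType) (V : seq G) :=
  forall w w' : seq G, size w = size w' -> {subset w <= V} -> {subset w' <= V} ->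
    (\prod_(s <- w) s = \prod_(s <- w') s)%g -> w = w'.

(** * Free sets from clash-free families *)

Section FreeSets.
Context (R : realType) (G : groupType) (X : metricType R) (act : G -> X -> X).
Hypothesis act_action : is_action act.
Hypothesis act_isom : isometric_action act.
Context (delta : R).
Hypothesis hyp : forall w x y z : X,
  Num.min (gp w x y) (gp w y z) - delta <= gp w x z.
Hypothesis delta_ge1 : 1 <= delta.
Variables (b : G) (o : X).
Local Notation t n := (d o (act (b ^+ n)%g o)).
Hypothesis b_straight : gp o (act b^-1%g o) (act b o) <= 7 * delta.
Hypothesis b_long : 1000 * delta <= t 1.
Variables (p : X) (M m : nat).
Hypothesis p_between : d o p + d p (act b o) = t 1.
Hypothesis p_few : few_movers act M (200 * delta) p.
Hypothesis m_large : (10 * (M + 100) <= m)%N.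

Local Notation tip := (act (b ^+ m)%g o).
Local Notation R0 := ((M + 84)%:R * t 1).

(** The threshold exceeds the [(M + 80)%:R * t 1] of [commute_of_follow] by [4 * t 1], leaving room
    for a change of base point from [o] to [u o]. *)
Definition clash (u v : G) := (u == v) || (R0 < gp o (act u tip) (act v tip)).
(** The letter [u b^m] starts towards [b^-m o], so it may cancel the end of a preceding letter. The
    margin [2 * delta] makes two backward elements clash. *)
Definition backward (u : G) := R0 + 2 * delta < gp o (act (b ^+ m)^-1%g o) (act u tip).

Lemma clash_refl : reflexive clash.
Proof. by move=> u; rewrite /clash eqxx. Qed.

Lemma clash_sym : symmetric clash.
Proof. by move=> u v; rewrite /clash eq_sym gpC. Qed.

Lemma clash_commute u v : d o (act u o) <= 4 * t 1 -> d o (act v o) <= 4 * t 1 ->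
  clash u v -> exists2 k, (0 < k)%N & commute (u^-1 * v)%g (b ^+ k)%g.
Proof.
move=> ou ov /orP[/eqP<-|uv].
  by exists 1%N => //; rewrite mulVg; exact/commute_sym/commute1.
have le : (M + 80)%:R * t 1 <= gp o tip (act (u^-1 * v)%g tip).
  rewrite -(gp_act act_isom u) -[act u (act (u^-1 * v)%g _)]actM // mulVKg.
  have := gp_base o (act u o) (act u tip) (act v tip).
  by move: uv; rewrite !natrD !mulrDl; lra.
have small : d o (act (u^-1 * v)%g o) <= 8 * t 1.
  have := dist_act_mul act_action act_isom u^-1%g v o.
  by rewrite dist_act_inv //; lra.
have [k k0 E] := commute_of_follow act_action act_isom hyp delta_ge1 b_straight
  b_long p_between p_few m_large (fun=> erefl) small le.
by exists k.
Qed.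

Lemma backward_clash u v : backward u -> backward v -> clash u v.
Proof.
move=> bu bv; apply/orP; right; have d1 := delta_ge1.
rewrite /backward in bu bv; rewrite gpC in bu.
by have [h|h] := gp_hyp hyp o (act u tip) (act (b ^+ m)^-1%g o) (act v tip); lra.
Qed.

(** These are the hypotheses of [word_inj]: absence of clashes separates the letters, absence of
    backward elements bounds the turns, and the size of [m] makes each letter longer than twice the
    turn bound. *)
Lemma free_of_packing (U : seq G) : uniq U ->
    {in U, forall u, d o (act u o) <= 4 * t 1} ->
    {in U &, forall u v, u != v -> ~~ clash u v} ->
    {in U, forall u, ~~ backward u} ->
  freely_multiplies [seq (u * b ^+ m)%g | u <- U].
Proof.
move=> uU small pack fwd; have d1 := delta_ge1; have bl := b_long.
have tm := dist_expg_m_ge act_action act_isom hyp delta_ge1 b_straight b_long m_large.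
have A0 : 0 <= M%:R * t 1 by rewrite mulr_ge0 // dist_ge0.
have R0E : R0 = M%:R * t 1 + 84 * t 1 by rewrite natrD mulrDl.
set V := [seq _ | u <- U].
have long v : v \in V -> t m - 4 * t 1 <= d o (act v o).
  move=> /mapP[u uU' ->]; rewrite actM //.
  have := dist_triangle (act u o) o (act u tip); rewrite dist_isom //.
  by have := small _ uU'; rewrite (distC (act u o)); lra.
have d0 : 0 <= delta by lra.
move=> w w' ww' /allP wV /allP w'V.
apply: (@word_inj _ _ _ act act_action act_isom delta hyp d0 (mem V) o
  (R0 + 3 * delta) R0) => //.
- move=> _ _ /mapP[u uU' ->] /mapP[v vU' ->].
  have fv := fwd _ vU'; rewrite /backward -leNgt in fv.
  have su := small _ uU'; rewrite invgM !actM //.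
  have h1 : t m - 4 * t 1 <=
      gp o (act (b ^+ m)^-1%g o) (act (b ^+ m)^-1%g (act u^-1%g o)).
    have := gp_ge o (act (b ^+ m)^-1%g o) (act (b ^+ m)^-1%g (act u^-1%g o)).
    by rewrite dist_isom // dist_expVg // dist_act_inv //; lra.
  by have [h|h] := gp_hyp hyp o (act (b ^+ m)^-1%g o)
    (act (b ^+ m)^-1%g (act u^-1%g o)) (act v tip); lra.
- move=> _ _ /mapP[u uU' ->] /mapP[v vU' ->] uv.
  have uv' : u != v by apply: contra uv => /eqP->.
  have := pack _ _ uU' vU' uv'; rewrite /clash negb_or -leNgt !actM //.
  by case/andP.
- by move=> v /long; lra.
- by move=> v /long; lra.
Qed.

(** Backward elements clash with one another, so a clash-free family has at most one; it is
    dropped. *)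
Lemma free_of_packing_but1 (U : seq G) : uniq U ->
    {in U, forall u, d o (act u o) <= 4 * t 1} ->
    {in U &, forall u v, u != v -> ~~ clash u v} ->
  exists U', [/\ uniq U', {subset U' <= U}, (size U <= (size U').+1)%N &
    freely_multiplies [seq (u * b ^+ m)%g | u <- U']].
Proof.
move=> uU small pack; exists [seq u <- U | ~~ backward u].
have sub : {subset [seq u <- U | ~~ backward u] <= U} by exact: mem_subseq (filter_subseq _ _).
split => //; first exact: filter_uniq.
- rewrite size_filter -(count_predC backward U) -addn1 addnC leq_add2l.
  apply: count_le1 => // u v uU' vU' bu bv; apply/eqP; apply: contraT => uv.
  by have := pack _ _ uU' vU' uv; rewrite backward_clash.
- apply: free_of_packing.
  + exact: filter_uniq.
  + by move=> u /sub; exact: small.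
  + by move=> u v /sub uU' /sub; exact: pack.
  + by move=> u; rewrite mem_filter => /andP[].
Qed.

Variable h : G.
Hypothesis h_transverse : ~ coarsely_normalizes b h.
Hypothesis h_le : d o (act h o) <= 2 * t 1.

Lemma free_pair : freely_multiplies [seq (u * b ^+ m)%g | u <- [:: 1%g; h]].
Proof.
have d1 := delta_ge1; have bl := b_long.
have hl2 := h_le; have hl : d o (act h o) <= 8 * t 1 by lra.
have lt := transverse_gp_lt act_action act_isom hyp delta_ge1 b_straight b_long
  p_between p_few m_large h_transverse hl.
have ltb := lt _ (or_introl erefl); have ltV := lt _ (or_intror erefl).
rewrite expVgn in ltV; rewrite natrD mulrDl in ltb ltV.
have R0E : R0 = M%:R * t 1 + 84 * t 1 by rewrite natrD mulrDl.
have h1 : h != 1%g.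
  apply/eqP => h1; apply: h_transverse; rewrite h1.
  by exists 1%N => //; left; rewrite mul1g mulg1.
apply: free_of_packing.
- by rewrite /= inE eq_sym h1.
- by move=> u; rewrite !inE => /orP[]/eqP->; rewrite ?act1 ?distxx //; lra.
- have c1h : ~~ clash 1%g h.
    by rewrite /clash eq_sym (negbTE h1) /= -leNgt act1 //; lra.
  move=> u v; rewrite !inE => /orP[]/eqP-> /orP[]/eqP->; rewrite ?eqxx //.
  by rewrite clash_sym.
- move=> u; rewrite !inE => /orP[]/eqP->; rewrite /backward -leNgt; last lra.
  rewrite act1 // gpE dist_expg_expVg // dist_expVg //.
  have := dist_expg_ge_add act_action act_isom hyp delta_ge1 b_straight b_long m m.
  have A0 : 0 <= M%:R * t 1 by rewrite mulr_ge0 // dist_ge0.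
  lra.
Qed.

(* The elements of [A] clashing with a given one almost normalise the axis of
   [b]; multiplied by [h] they clash only when they also almost normalise its
   translate by [h], which happens at most [M] times. *)
Lemma packing_after_transverse (y : G) (E : seq G) : uniq E ->
    d o (act y o) <= 2 * t 1 ->
    {in E, forall e, d o (act e o) <= 2 * t 1 /\ clash y e} ->
  exists F, [/\ uniq F, {subset F <= E}, (size E <= M * size F)%N &
    {in F &, forall e f, e != f -> ~~ clash (e * h)%g (f * h)%g}].
Proof.
move=> uE yl EP; have b0 := dist_ge0 o (act (b ^+ 1)%g o).
have [F [uF sF pF cF]] := @maximal_packing _ (relpre (fun e => (e * h)%g) clash)
  (fun e => clash_refl _) (fun e f => clash_sym _ _) E uE.
exists F; split => //.
apply: size_le_cover cF _; first by move=> e f; exact: clash_sym.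
move=> e /sF eE; rewrite -size_filter -(size_map (fun f => (e^-1 * f)%g)).
apply: p_few; first by rewrite map_inj_uniq ?filter_uniq //; exact: mulgI.
move=> _ /mapP[f + ->]; rewrite mem_filter => /andP[/= cef fE].
have [el ye] := EP _ eE; have [fl yf] := EP _ fE.
have le2 z : d o (act z o) <= 2 * t 1 -> d o (act z o) <= 4 * t 1 by lra.
have le4 z : d o (act z o) <= 2 * t 1 -> d o (act (z * h)%g o) <= 4 * t 1.
  by move=> zl; have := dist_act_mul act_action act_isom z h o; have := h_le; lra.
have [k k0 ck] := clash_commute (le2 _ yl) (le2 _ el) ye.
have [l l0 cl] := clash_commute (le2 _ yl) (le2 _ fl) yf.
have [n n0 cn] := clash_commute (le4 _ el) (le4 _ fl) cef.
have hl : d o (act h o) <= 8 * t 1 by have := h_le; lra.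
have := small_move_of_commute act_action act_isom hyp delta_ge1 b_straight b_long
  p_between p_few m_large h_transverse hl (f := (e^-1 * f)%g) (k := (k * l)%N) _ n0.
rewrite muln_gt0 k0 l0 => /(_ isT); have := delta_ge1.
have fE' : (e^-1 * f = (y^-1 * e)^-1 * (y^-1 * f))%g by rewrite invgM invgK mulgA mulgK.
move=> d1 small; apply: le_trans (small _ _) _; last lra.
  rewrite fE'; apply/commute_sym/commuteM; last first.
    by apply/commute_sym; rewrite mulnC expgnA; exact: commuteX.
  by apply/commuteV/commute_sym; rewrite expgnA; exact: commuteX.
by move: cn; rewrite invgM !mulgA.
Qed.

End FreeSets.

(** * Free sets of square-root size *)

Section FreeSetsInCuspedSpaces.
Context (R : realType) (G : groupType) (X : metricType R) (act : G -> X -> X).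
Hypothesis act_action : is_action act.
Hypothesis act_isom : isometric_action act.
Hypothesis geod : geodesic_space X.
Context (delta : R).
Hypothesis hyp : forall w x y z : X,
  Num.min (gp w x y) (gp w y z) - delta <= gp w x z.
Hypothesis delta_ge1 : 1 <= delta.
Variable UU : set (set X).
Hypothesis UU_horoballs : horoball_system act UU.
Local Notation thick := (~` \bigcup_(U in UU) U).

Lemma horoball_systemP :
  [/\ forall U, UU U -> open U, forall g U, UU U -> UU (act g @` U) &
      trivIset UU id].
Proof.
case: UU_horoballs => h1 h2 h3; split => // U /h1[xi [_ [oU _]]].
exact: oU.
Qed.

Lemma almost_minimal_displacement (A : seq G) : A != [::] -> X ->
  exists o (L : R), (forall a, a \in A -> d o (act a o) <= L) /\
    forall y, exists2 a, a \in A & L - 1 < d y (act a y).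
Proof.
move=> A0 x0; case: A A0 => // a0 A _.
pose E := [set r : R | exists y, forall a, a \in a0 :: A -> d y (act a y) <= r].
have infE : has_inf E.
  split.
    exists (\sum_(a <- a0 :: A) d x0 (act a x0)), x0 => a aA.
    rewrite (big_rem a aA) /= lerDl; apply: sumr_ge0 => ? _; exact: dist_ge0.
  by exists 0 => r [y /(_ _ (mem_head _ _))]; apply: le_trans; exact: dist_ge0.
have [L [z zL] Linf] := inf_adherent ltr01 infE.
exists z, L; split => // y; apply: contrapT => no.
have : E (L - 1).
  exists y => a aA; rewrite leNgt; apply/negP => lt; apply: no.
  by exists a.
by move/(ge_inf infE.2); lra.
Qed.

Variable M : nat.
Hypothesis thick_few : forall p, thick p -> few_movers act M (200 * delta) p.
Variables (H : set G) (A : seq G).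
Hypothesis A_uniq : uniq A.
Hypothesis A_sym : symmetric_set [set` A].
Hypothesis A_gen : generates [set` A] H.
Hypothesis H_ne : non_elementary act H.
Hypothesis A_large : forall y, exists2 a, a \in A & 3000 * delta < d y (act a y).

Let m := (10 * (M + 100))%N.

(** The counts give |A| <= M |F| |T|, and the larger of [F] and [T] yields [V] after dropping at
    most one element. If it has at most two elements, |A| <= 4 M and the pair [1], [h] suffices. *)
Lemma exists_free_set : exists V : seq G,
  [/\ uniq V, (1 < size V)%N, (size A <= 4 * M * size V ^ 2)%N,
      forall v, v \in V -> is_word [set` A] (2 * m + 2) v &
      freely_multiplies V].
Proof.
have d1 := delta_ge1; have [UU_open UU_act UU_triv] := horoball_systemP.
have [x0 _] : exists x : X, True.
  by have [xi [_ [_ [[_ [x _]] _ _ _]]]] := H_ne; exists x.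
have A0 : A != [::].
  by have [a aA _] := A_large x0; apply/eqP => A0; rewrite A0 in aA.
have [] := almost_minimal_displacement A0 x0; move=> o [L [oL yL]].
have L_large : 3000 * delta <= L.
  by have [a aA /ltW lt] := A_large o; exact: le_trans lt (oL a aA).
have L_large' : 1000 * delta <= L by lra.
have [b [bA bs bl]] := @exists_straight_element _ _ _ _ act_action act_isom geod
  delta hyp delta_ge1 [set` A] o L A_sym oL yL L_large'.
have t1E : d o (act (b ^+ 1)%g o) = d o (act b o) by rewrite expg1.
have b_long : 1000 * delta <= d o (act (b ^+ 1)%g o) by rewrite t1E; lra.
have oA a : a \in A -> d o (act a o) <= 2 * d o (act (b ^+ 1)%g o).
  by move=> /oL; rewrite t1E; lra.
have [p tp pb] : exists2 p, thick p & d o p + d p (act b o) = d o (act (b ^+ 1)%g o).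
  rewrite t1E; have [//|[U [UUU Uo bU]]] :=
    thick_between_or_stable geod UU_open UU_act UU_triv o b.
  case: UU_horoballs => /(_ U UUU)[xi [pxi hU]] _ _; exfalso; move: bU.
  exact: (straight_not_stable act_action act_isom hyp delta_ge1 bs b_long pxi hU Uo).
have pf := thick_few tp.
have [h hA ht] : exists2 h, h \in A & ~ coarsely_normalizes b h.
  apply: contrapT => no.
  have HN : H `<=` coarsely_normalizes b.
    rewrite -A_gen; apply: smallest_sub; first exact: coarsely_normalizes_subgroup.
    by move=> a aA; apply: contrapT => na; apply: no; exists a.
  apply: (non_elementary_not_near_axis act_action act_isom hyp delta_ge1 H_ne
    bs b_long) => g /HN.
  exact: (coarsely_normalizes_near_axis act_action act_isom hyp delta_ge1 bs b_long).
have hl := oA _ hA.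
have bw : is_word [set` A] 2 b.
  case: bA => [bA|[s [s' [sA sA' ->]]]].
    by apply: is_word_leq (is_word_gen bA).
  by apply: (@is_wordM _ _ 1 1); exact: is_word_gen.
have tw n u : (n <= 2)%N -> is_word [set` A] n u ->
    is_word [set` A] (2 * m + 2) (u * b ^+ m)%g.
  move=> n2 uw; rewrite addnC; apply: is_wordM; first exact: is_word_leq uw.
  by rewrite mulnC; exact: is_word_expg.
have conclude (U : seq G) : uniq U -> (forall u, u \in U -> is_word [set` A] 2 u) ->
    freely_multiplies [seq (u * b ^+ m)%g | u <- U] -> (1 < size U)%N ->
    (size A <= 4 * M * size U ^ 2)%N ->
  exists V : seq G, [/\ uniq V, (1 < size V)%N, (size A <= 4 * M * size V ^ 2)%N,
      forall v, v \in V -> is_word [set` A] (2 * m + 2) v & freely_multiplies V].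
  move=> uU Uw fU U1 AU; exists [seq (u * b ^+ m)%g | u <- U].
  rewrite size_map; split => //; first by rewrite map_inj_uniq //; exact: mulIg.
  by move=> _ /mapP[u uU' ->]; apply: (tw 2%N) => //; exact: Uw.
have [T [uT sT pT cT]] := maximal_packing (clash_refl act b o M m)
  (clash_sym act b o M m) A_uniq.
have [y yT sy] := packing_size_le (clash_sym act b o M m) cT A0.
have le4 u : d o (act u o) <= 2 * d o (act (b ^+ 1)%g o) ->
    d o (act u o) <= 4 * d o (act (b ^+ 1)%g o).
  by have := dist_ge0 o (act (b ^+ 1)%g o); lra.
have [U1 [uU1 sU1 TU1 fU1]] := free_of_packing_but1 act_action act_isom hyp delta_ge1
  bs b_long (leqnn m) uT (fun u uT' => le4 u (oA u (sT u uT'))) pT.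
pose E := [seq e <- A | clash act b o M m y e].
have EP : {in E, forall e, d o (act e o) <= 2 * d o (act (b ^+ 1)%g o) /\
    clash act b o M m y e}.
  by move=> e; rewrite mem_filter => /andP[ye eA]; split => //; exact: oA.
have [F [uF sF EF pF]] := packing_after_transverse act_action act_isom hyp delta_ge1
  bs b_long pb pf (leqnn m) ht hl (filter_uniq _ A_uniq) (oA y (sT y yT)) EP.
have uFh : uniq [seq (e * h)%g | e <- F] by rewrite map_inj_uniq //; exact: mulIg.
have Fh4 : {in [seq (e * h)%g | e <- F], forall u, d o (act u o) <=
    4 * d o (act (b ^+ 1)%g o)}.
  move=> _ /mapP[e /sF/EP[el _] ->].
  by have := dist_act_mul act_action act_isom e h o; lra.
have pFh : {in [seq (e * h)%g | e <- F] &, forall u v, u != v ->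
    ~~ clash act b o M m u v}.
  move=> _ _ /mapP[e eF ->] /mapP[f fF ->] ef; apply: pF => //.
  by apply: contra ef => /eqP->.
have [U2 [uU2 sU2 FU2 fU2]] := free_of_packing_but1 act_action act_isom hyp delta_ge1
  bs b_long (leqnn m) uFh Fh4 pFh.
rewrite size_map in FU2.
have sA : (size A <= M * size F * size T)%N.
  by apply: leq_trans sy _; rewrite leq_mul2r -size_filter EF orbT.
(* Dropping one of [k > 2] elements leaves at least half of them, whence the factor [4] after
   squaring. *)
have sqr (n k l : nat) : (l <= k)%N -> (n <= M * k * l)%N -> (2 < k)%N ->
    forall s, (k <= s.+1)%N -> (1 < s)%N /\ (n <= 4 * M * s ^ 2)%N.
  clear; move=> lk nk k2 s ks; split; first by move: k2 ks; clear; lia.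
  apply: leq_trans nk _; rewrite (mulnC 4%N) -!mulnA leq_mul2l; apply/orP; right.
  apply: (@leq_trans (s.+1 * s.+1)%N); first by rewrite leq_mul // (leq_trans lk).
  by rewrite -[leqRHS]/(4 * (s * s))%N; move: k2 ks; clear; nia.
have w1 u : u \in U1 -> is_word [set` A] 2 u.
  by move=> /sU1/sT uA; apply: is_word_leq (is_word_gen uA).
have w2 u : u \in U2 -> is_word [set` A] 2 u.
  move=> /sU2/mapP[e /sF + ->]; rewrite mem_filter => /andP[_ eA].
  by apply: (@is_wordM _ _ 1 1); exact: is_word_gen.
have pair : (size A <= 16 * M)%N -> exists V : seq G,
    [/\ uniq V, (1 < size V)%N, (size A <= 4 * M * size V ^ 2)%N,
      forall v, v \in V -> is_word [set` A] (2 * m + 2) v & freely_multiplies V].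
  move=> A16; apply: (conclude [:: 1%g; h]) => //.
  - rewrite /= inE andbT; apply/eqP => h1; apply: ht; rewrite -h1.
    by exists 1%N => //; left; rewrite mul1g mulg1.
  - by move=> u; rewrite !inE => /orP[]/eqP->; [exact: is_word1 |
      apply: is_word_leq (is_word_gen hA)].
  - exact: (free_pair act_action act_isom hyp delta_ge1 bs b_long pb pf (leqnn m) ht hl).
  - by rewrite /=; move: A16; clear; lia.
have [TF|/ltnW FT] := leqP (size T) (size F).
  have [F2|F2] := leqP (size F) 2; last first.
    by have [] := sqr _ _ _ TF sA F2 _ FU2; exact: conclude.
  apply: pair; apply: leq_trans sA _; rewrite -mulnA mulnC leq_mul2r.
  by apply/orP; right; move: F2 TF; clear; nia.
have [T2|T2] := leqP (size T) 2; last first.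
  rewrite -mulnA (mulnC (size F)) mulnA in sA.
  by have [] := sqr _ _ _ FT sA T2 _ TU1; exact: conclude.
apply: pair; apply: leq_trans sA _; rewrite -mulnA mulnC leq_mul2r.
by apply/orP; right; move: T2 FT; clear; nia.
Qed.

End FreeSetsInCuspedSpaces.

(** * Fekete's lemma for subadditive sequences *)

Section Fekete.
Context (R : realType) (u : nat -> R).
Hypothesis u_ge0 : forall n, 0 <= u n.
Hypothesis u_sub : forall m n, u (m + n)%N <= u m + u n.

Lemma subadditive_mul_le q n : u (q.+1 * n)%N <= q.+1%:R * u n.
Proof.
elim: q => [|q IH]; first by rewrite mul1n mul1r.
rewrite mulSn; apply: le_trans (u_sub _ _) _.
by rewrite -[in leRHS]natr1 mulrDl mul1r addrC lerD2r.
Qed.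

(** The ratios converge to their infimum, so [limn] is a genuine limit and inherits every lower
    bound. The infimum is over positive [n] because the ratio at [0] is [0] by convention. *)
Lemma subadditive_ratio_cvg (c : R) : (forall n, (0 < n)%N -> c <= u n / n%:R) ->
  c <= limn (fun n => u n / n%:R).
Proof.
move=> cu; pose E := [set u n / n%:R | n in [set n | (0 < n)%N]].
have infE : has_inf E.
  split; first by exists (u 1%N / 1%:R), 1%N.
  by exists 0 => _ [n _ <-]; rewrite divr_ge0.
suff lim : (fun n => u n / n%:R) @ \oo --> inf E.
  rewrite (cvg_lim _ lim) //; apply: lb_le_inf; first exact: infE.1.
  by move=> _ [n n0 <-]; exact: cu.
apply/cvgrPdist_le => e e0.
have e20 : 0 < e / 2 by rewrite divr_gt0.
have [_ [k k0 <-] kE] := inf_adherent e20 infE.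
pose C := \sum_(i < k) u i.
near=> n.
have n0 : (0 < n)%N by near: n; exists 1%N.
have n0R : 0 < n%:R :> R by rewrite ltr0n.
have lo : inf E <= u n / n%:R by apply: (ge_inf infE.2); exists n.
rewrite distrC ger0_norm ?subr_ge0 // lerBlDr.
have nC : C / n%:R <= e / 2.
  rewrite ler_pdivrMr // mulrC -ler_pdivrMr //.
  by near: n; exact: nbhs_infty_ger.
have uk : u n <= n%:R * (u k / k%:R) + C.
  have k0R : 0 < k%:R :> R by rewrite ltr0n.
  have uC : u (n %% k)%N <= C.
    rewrite /C (bigD1 (Ordinal (ltn_pmod n k0))) //= lerDl.
    by apply: sumr_ge0 => i _.
  have le1 : (n %/ k)%:R * u k <= n%:R * (u k / k%:R).
    rewrite [leRHS]mulrCA [leLHS]mulrC ler_wpM2l // ler_pdivlMr // -natrM ler_nat.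
    exact: leq_divM.
  (* [subadditive_mul_le] needs a positive multiple since [u 0] may be positive; a zero quotient is
     treated apart. *)
  have [nk|kn] := ltnP n k.
    rewrite modn_small // in uC; apply: le_trans uC _.
    by rewrite lerDr mulr_ge0 // divr_ge0.
  rewrite [in u n](divn_eq n k); apply: le_trans (u_sub _ _) (lerD _ uC).
  apply: le_trans le1; have : (0 < n %/ k)%N by rewrite divn_gt0.
  by case: (n %/ k)%N => // q _; exact: subadditive_mul_le.
have : u n / n%:R <= u k / k%:R + C / n%:R.
  by rewrite ler_pdivrMr // mulrDl mulfVK ?gt_eqF // mulrC.
by move/le_trans; apply; lra.
Unshelve. all: by end_near.
Qed.

End Fekete.

(** * Word balls and the growth rate *)

Section Balls.
Context (R : realType) (G : groupType) (S : set G).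
Hypothesis S_fin : finite_set S.
Hypothesis S_sym : symmetric_set S.

Lemma is_wordV n g : is_word S n g -> is_word S n g^-1%g.
Proof.
move=> [w [wn Sw <-]]; apply: is_word_leq wn _; elim: w Sw => [|s w IH] Sw.
  by rewrite big_nil invg1; exact: is_word1.
rewrite big_cons invgM /= -addn1; apply: is_wordM.
  by apply: IH => r rw; apply: Sw; rewrite inE rw orbT.
by apply: is_word_gen; apply/S_sym/Sw; rewrite mem_head.
Qed.

Lemma is_wordS n g : is_word S n.+1 g ->
  is_word S n g \/ exists a h, [/\ S a, is_word S n h & g = (a * h)%g].
Proof.
move=> [[|a w] [wn Sw <-]]; first by left; rewrite big_nil; exact: is_word1.
right; exists a, (\prod_(s <- w) s)%g; rewrite big_cons; split => //.
  by apply: Sw; rewrite mem_head.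
by exists w; split => // s sw; apply: Sw; rewrite inE sw orbT.
Qed.

Lemma finite_ball n : finite_set (is_word S n).
Proof.
elim: n => [|n IH].
  apply: (@sub_finite_set _ _ [set 1%g]); last exact: finite_set1.
  by move=> g [[|a w] [// _ _ <-]]; rewrite big_nil.
apply: (@sub_finite_set _ _ (is_word S n `|`
    (fun p : G * G => (p.1 * p.2)%g) @` (S `*` is_word S n))).
  move=> g /is_wordS[|[a [h [Sa wh ->]]]]; [by left|right].
  by exists (a, h).
by rewrite finite_setU; split => //; apply: finite_image; exact: finite_setX.
Qed.

Definition ball_size n := #|` fset_set (is_word S n)|.

Lemma uniq_size_le_ball n (s : seq G) : uniq s ->
  (forall g, g \in s -> is_word S n g) -> (size s <= ball_size n)%N.
Proof.
move=> us sn; apply: uniq_leq_size => // g /sn gn.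
by rewrite in_fset_set ?inE //; exact: finite_ball.
Qed.

Lemma mem_ball n g : (g \in fset_set (is_word S n)) <-> is_word S n g.
Proof. by rewrite in_fset_set ?inE //; exact: finite_ball. Qed.

Lemma ball_size_gt0 n : (0 < ball_size n)%N.
Proof.
by apply: (@uniq_size_le_ball n [:: 1%g]) => // g; rewrite inE => /eqP->; exact: is_word1.
Qed.

Lemma ball_sizeD m n : (ball_size (m + n) <= ball_size m * ball_size n)%N.
Proof.
rewrite /ball_size -(size_allpairs *%g); apply: uniq_leq_size; first exact: fset_uniq.
move=> g /mem_ball[w [wn Sw <-]]; rewrite -(cat_take_drop m w) big_cat /=.
apply: allpairs_f; apply/mem_ball.
  exists (take m w); split => //; first by rewrite size_take; case: ltnP.
  by move=> s /mem_take/Sw.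
exists (drop m w); split => //; first by rewrite size_drop leq_subLR.
by move=> s /mem_drop/Sw.
Qed.

Lemma ball_size_free (V : seq G) J n : uniq V -> freely_multiplies V ->
  (forall v, v \in V -> is_word S J v) -> (size V ^ n <= ball_size (n * J))%N.
Proof.
move=> uV fV VJ; pose W := {: n.-tuple (seq_sub V)}.
have -> : (size V ^ n = #|W|)%N by rewrite card_tuple card_seq_sub.
pose F (t : n.-tuple (seq_sub V)) := (\prod_(x <- map val t) x)%g.
have VF (t : n.-tuple (seq_sub V)) : {subset map val t <= V}.
  by move=> v /mapP[x _ ->]; exact: valP.
have Finj : injective F.
  move=> x y /fV; rewrite !size_map !size_tuple => /(_ erefl (VF _) (VF _)) E.
  by apply: val_inj; apply: inj_map E; exact: val_inj.
rewrite cardE -(size_map F); apply: uniq_size_le_ball.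
  by rewrite map_inj_uniq // enum_uniq.
move=> _ /mapP[t _ ->].
have := @is_word_prod _ S J (map val t); rewrite size_map size_tuple; apply.
by move=> v /VF; exact: VJ.
Qed.

Variable H : set G.
Hypothesis S_gen : generates S H.

Lemma generated_word g : H g -> exists n, is_word S n g.
Proof.
have sub : H `<=` [set g | exists n, is_word S n g].
  rewrite -S_gen; apply: smallest_sub; last by move=> s; exists 1%N; exact: is_word_gen.
  split; first by exists 0%N; exact: is_word1.
    by move=> h k [m hm] [n kn]; exists (m + n)%N; exact: is_wordM.
  by move=> h [n hn]; exists n; exact: is_wordV.
exact: sub.
Qed.

Lemma word_generated n g : is_subgroup H -> is_word S n g -> H g.
Proof.
move=> [H1 HM _] [w [_ Sw <-]]; elim: w Sw => [|s w IH] Sw; first by rewrite big_nil.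
rewrite big_cons; apply: HM.
  by rewrite -S_gen; apply: sub_gen_smallest; apply: Sw; rewrite mem_head.
by apply: IH => r rw; apply: Sw; rewrite inE rw orbT.
Qed.

Lemma word_ballE n : is_subgroup H -> word_ball R H S n = is_word S n.
Proof.
move=> sH; apply/seteqP; split => g; rewrite /word_ball /= /word_dist invg1 mul1g.
  set E := [set _ | _ in _] => -[Hg le].
  have infE : has_inf E.
    split; last by exists 0 => _ [w _ <-].
    by have [k [w [_ Sw wE]]] := generated_word Hg; exists (size w)%:R, w.
  (* Lengths are integers, so a word less than [1] above an infimum at most [n] has length at most
     [n]. *)
  have [_ [w [Sw wE] <-] lt] := inf_adherent ltr01 infE.
  exists w; split => //; rewrite -ltnS -(ltr_nat R) -natr1.
  by apply: lt_le_trans lt _; rewrite lerD2r.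
move=> wg; split; first exact: word_generated wg.
have [w [wn Sw wE]] := wg; apply: (@le_trans _ _ (size w)%:R); last by rewrite ler_nat.
by apply: ge_inf; [exists 0 => _ [v _ <-] | exists w].
Qed.

(** Freeness and submultiplicativity give [size V ^ n <= ball_size (n * J) <= ball_size n ^ J], so
    each ratio with [n] positive already satisfies the bound, and Fekete's lemma passes it to the
    limit. *)
Lemma growth_rate_ge (V : seq G) J : is_subgroup H -> (0 < J)%N -> uniq V ->
    (0 < size V)%N -> freely_multiplies V -> (forall v, v \in V -> is_word S J v) ->
  ln (size V)%:R / J%:R <= growth_rate R H S.
Proof.
move=> sH J0 uV V0 fV VJ; rewrite /growth_rate.
under eq_fun do rewrite word_ballE // -/(ball_size _).
have pos n : 0 < (ball_size n)%:R :> R by rewrite ltr0n ball_size_gt0.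
apply: (@subadditive_ratio_cvg R (fun n => ln (ball_size n)%:R)).
- by move=> n; apply: ln_ge0; rewrite ler1n ball_size_gt0.
- move=> m n; rewrite -lnM ?posrE // -natrM ler_ln ?posrE ?ler_nat ?ball_sizeD //.
  by rewrite ltr0n muln_gt0 !ball_size_gt0.
- move=> n n0; rewrite ler_pdivlMr ?ltr0n // mulrAC ler_pdivrMr ?ltr0n //.
  rewrite !mulr_natr -!lnXn ?ltr0n ?ball_size_gt0 // -!natrX.
  rewrite ler_ln ?posrE ?ltr0n ?expn_gt0 ?V0 ?ball_size_gt0 // ler_nat.
  apply: leq_trans (ball_size_free n uV fV VJ) _.
  case: J J0 {VJ} => // J _; elim: J => [|J IH]; first by rewrite muln1 expn1.
  by rewrite mulnS expnS; apply: leq_trans (ball_sizeD _ _) _; rewrite leq_mul2l IH orbT.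
Qed.

End Balls.

Lemma stabilizer_subgroup (G : groupType) (X : Type) (act : G -> X -> X) (U : set X) :
  is_action act -> is_subgroup [set h | act h @` U = U].
Proof.
move=> [a1 aM].
have aV h : act h @` U = U -> act h^-1%g @` U = U.
  move=> hU; rewrite -{1}hU image_comp -[RHS]image_id; apply: eq_imagel => x _ /=.
  by rewrite -aM mulVg a1.
split => /= [|g h gU hU|]; last exact: aV.
  by rewrite -[RHS]image_id; apply: eq_imagel => x _; rewrite a1.
by rewrite -[RHS]gU -[in RHS]hU image_comp; apply: eq_imagel => x _ /=; rewrite aM.
Qed.

(** * Balls of uniform radius with large displacement *)

Section LargeBalls.
Context (R : realType) (G : groupType) (X : metricType R) (act : G -> X -> X).
Hypothesis act_action : is_action act.
Hypothesis act_isom : isometric_action act.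
Hypothesis geod : geodesic_space X.
Context (delta : R).
Hypothesis hyp : forall w x y z : X,
  Num.min (gp w x y) (gp w y z) - delta <= gp w x z.
Hypothesis delta_ge1 : 1 <= delta.
Variable UU : set (set X).
Hypothesis UU_horoballs : horoball_system act UU.
Local Notation thick := (~` \bigcup_(U in UU) U).
Variables (r : R) (M : nat).
Hypothesis thick_few : forall p, thick p -> few_movers act M (3 * r) p.
Variables (H S : set G).
Hypothesis H_ne : non_elementary act H.
Hypothesis S_fin : finite_set S.
Hypothesis S_sym : symmetric_set S.
Hypothesis S_gen : generates S H.

(** A ball that stops growing is stable under the generators and exhausts [H], which is infinite. *)
Lemma ball_size_gt n : (n < ball_size S n)%N.
Proof.
elim: n => [|n IH]; first exact: ball_size_gt0.
apply: leq_ltn_trans IH _; rewrite ltnNge; apply/negP => le.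
have stable g : is_word S n.+1 g -> is_word S n g.
  move=> /(mem_ball S_fin) gn; apply/(mem_ball S_fin); move: g gn.
  apply/fsubsetP; rewrite (_ : fset_set (is_word S n) = fset_set (is_word S n.+1)) //.
  apply/eqP; rewrite eqEfcard le andbT; apply/fsubsetP => g /(mem_ball S_fin) gn.
  by apply/(mem_ball S_fin); exact: is_word_leq gn.
have all k g : is_word S k g -> is_word S n g.
  elim: k g => [|k IHk] g; first exact: is_word_leq.
  move=> /is_wordS[/IHk //|[a [h [Sa /IHk hn ->]]]]; apply: stable.
  by rewrite -add1n; apply: is_wordM => //; exact: is_word_gen.
apply: (non_elementary_infinite H_ne (s := fset_set (is_word S n))) => h.
by move=> /(generated_word S_sym S_gen)[k /all]; move/(mem_ball S_fin).
Qed.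

(* If the ball moved some point by at most [r], then either this point lies
   in a horoball stable under [H], or a thick point near it would be moved
   little by too many elements. *)
Lemma ball_large_displacement (y : X) :
  exists2 a, is_word S M.+1 a & r < d y (act a y).
Proof.
apply: contrapT => no.
have small a : is_word S M.+1 a -> d y (act a y) <= r.
  by move=> aw; rewrite leNgt; apply/negP => lt; apply: no; exists a.
have [UU_open UU_act UU_triv] := horoball_systemP UU_horoballs.
have tos := thick_between_or_stable geod UU_open UU_act UU_triv y.
have [[a [aw [p tp yp]]]|nt] := pselect (exists a, is_word S M.+1 a /\
    exists2 p, thick p & d y p + d p (act a y) = d y (act a y)).
  (* The ball has more than [M + 1] elements, each moving [p] by at most [3 * r]: at most [r] for
     [y] itself and twice the distance from [p] to [y]. *)
  have := ball_size_gt M.+1; apply/negP; rewrite -leqNgt leqW //.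
  apply: (thick_few tp); first exact: fset_uniq.
  move=> g /(mem_ball S_fin) /small gy; have ay := small _ aw.
  have := dist_triangle p y (act g p); have := dist_triangle y (act g y) (act g p).
  rewrite dist_isom // (distC p y); have := dist_ge0 p (act a y).
  lra.
have st a : is_word S M.+1 a -> exists U, [/\ UU U, U y & act a @` U = U].
  by move=> aw; have [?|//] := tos a; exfalso; apply: nt; exists a.
have [U [UUU Uy _]] := st _ (is_word1 S M.+1).
case: UU_horoballs => /(_ U UUU)[xi [pxi hU]] _ _.
apply: (non_elementary_not_stable act_isom hyp delta_ge1 H_ne pxi hU Uy).
rewrite -S_gen; apply: smallest_sub; first exact: stabilizer_subgroup.
move=> a Sa /=; have [|V [UV Vy aV]] := st a.
  by apply: is_word_leq (is_word_gen Sa).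
by rewrite (UU_eq UU_triv UUU UV Uy Vy).
Qed.

End LargeBalls.

(** * Assembly of the uniform constant *)

Theorem theorem1p1 (R : realType) (G : groupType) (X : metricType R)
    (act : G -> X -> X) :
  finitely_generated G ->
  cusp_uniform act ->
  non_elementary act [set: G] ->
  exists kappa : R, 0 < kappa <= 1 /\
    forall H : set G, is_subgroup H -> non_elementary act H ->
    forall S : set G, finite_set S -> symmetric_set S -> generates S H ->
      kappa * ln (#|` fset_set S|%:R : R) <= growth_rate R H S.
Proof.
move=> _ [X_proper geod [delta0 hyp0] act_action act_isom act_proper _] [UU [hU cU]] _.
(* Being at least [1], [delta] absorbs additive constants such as the [1] of the almost minimal
   displacement. *)
pose delta := Num.max delta0 1.
have delta_ge1 : 1 <= delta by rewrite le_max lexx orbT.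
have hyp (w x y z : X) : Num.min (gp w x y) (gp w y z) - delta <= gp w x z.
  apply: le_trans (hyp0 w x y z); rewrite lerD2l lerN2 le_max lexx //.
have few r := uniformly_few_movers act_action act_isom X_proper act_proper cU r.
have [M M_few] := few (200 * delta); have [N N_few] := few (3 * (3000 * delta)).
(* Length over [S] of a word of length [2 * m + 2] in elements of the ball of radius [N + 1], with
   [m = 10 * (M + 100)]. *)
pose J := ((2 * (10 * (M + 100)) + 2) * N.+1)%N.
(* From |S| <= 4 (M + 1) |V|^2 and |V| >= 2 follows log |S| <= c log |V|; [M.+1] keeps the argument
   of the logarithm positive. *)
pose c : R := 2 + ln (4 * M.+1)%:R / ln 2.
have J0 : (0 < J)%N by rewrite muln_gt0 addn_gt0 orbT.
have J0R : 0 < J%:R :> R by rewrite ltr0n.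
have ln2 : 0 < ln (2 : R) by rewrite ln_gt0 // ltr1n.
have c0 : 0 < c.
  by rewrite ltr_pwDl // divr_ge0 ?(ltW ln2) // ln_ge0 // ler1n.
exists (Num.min 1 (J%:R * c)^-1); split.
  by rewrite lt_min ltr01 invr_gt0 mulr_gt0 //= ge_min lexx.
move=> H sH H_ne S S_fin S_sym S_gen.
pose A : seq G := fset_set (is_word S N.+1).
have AE a : a \in A <-> is_word S N.+1 a by exact: mem_ball.
have A_sym : symmetric_set [set` A].
  by move=> a /AE aw; apply/AE; exact: is_wordV.
have SA s : S s -> is_word S N.+1 s.
  by move=> Ss; apply: is_word_leq (is_word_gen Ss).
have A_gen : generates [set` A] H.
  rewrite /generates; apply/seteqP; split.
    by apply: smallest_sub => // a /AE; exact: word_generated.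
  move=> h Hh K [sK AK]; rewrite -S_gen in Hh; apply: Hh; split => // s /SA /AE.
  exact: AK.
have A_large y : exists2 a, a \in A & 3000 * delta < dist y (act a y).
  have [a /AE aA lt] := ball_large_displacement act_action act_isom geod hyp
    delta_ge1 hU N_few H_ne S_fin S_sym S_gen y.
  by exists a.
have [V [uV V1 AV Vw fV]] := exists_free_set act_action act_isom geod hyp delta_ge1
  hU M_few (fset_uniq _) A_sym A_gen H_ne A_large.
have VJ v : v \in V -> is_word S J v.
  move=> /Vw[w [ww wA <-]]; apply: is_word_leq (leq_mul ww (leqnn N.+1)) _.
  by apply: is_word_prod => s /wA /AE.
apply: le_trans (growth_rate_ge R S_fin S_sym S_gen sH J0 uV (ltnW V1) fV VJ).
have lnV : ln 2 <= ln (size V)%:R :> R.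
  by rewrite ler_ln ?posrE ?ltr0n ?(ltnW V1) // ler_nat.
have lnS : ln (#|` fset_set S|%:R : R) <= c * ln (size V)%:R.
  have [->|S0] := posnP #|` fset_set S|.
    by rewrite ln0 // mulr_ge0 ?(ltW c0) // (le_trans (ltW ln2)).
  have SV : (#|` fset_set S| <= 4 * M.+1 * size V ^ 2)%N.
    apply: (@leq_trans (size A)).
      apply: uniq_leq_size => // s; rewrite in_fset_set // inE => /SA /AE //.
    by apply: leq_trans AV _; rewrite leq_mul // leq_mul.
  apply: (@le_trans _ _ (ln (4 * M.+1 * size V ^ 2)%:R)).
    by rewrite ler_ln ?posrE ?ltr0n ?muln_gt0 ?expn_gt0 ?(ltnW V1) // ler_nat.
  have Vpos : 0 < (size V)%:R :> R by rewrite ltr0n ltnW.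
  rewrite natrM lnM ?posrE ?ltr0n ?expn_gt0 ?(ltnW V1) // natrX lnXn //.
  rewrite /c mulrDl -[ln _ *+ 2]mulr_natl addrC lerD2l.
  rewrite mulrAC -ler_pdivrMr ?invr_gt0 // invrK.
  by rewrite ler_wpM2l // ln_ge0 // ler1n.
have lnS0 : 0 <= ln (#|` fset_set S|%:R : R).
  have [->|S0] := posnP #|` fset_set S|; first by rewrite ln0.
  by rewrite ln_ge0 // ler1n.
apply: (@le_trans _ _ ((J%:R * c)^-1 * ln #|` fset_set S|%:R)).
  by rewrite ler_wpM2r // ge_min lexx orbT.
rewrite invfM -mulrA mulrC ler_pM2r ?invr_gt0 //.
by rewrite mulrC ler_pdivrMr // mulrC.
Qed.
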